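(* Let $\kappa=\frac4{27}$ and let $e_n(x)$ be the polynomials of the context. For each parameter tuple $(a,b,c,d)$ below and every integer $n\ge0$, the type I multiple orthogonal polynomials $A^{(n+2)}_1,A^{(n+2)}_2$ (defined in the context) are given by (with $e_k=e_k(x)$): $(\frac13,\frac23,\frac12,1)$: $A_1^{(n+2)}=(\frac{729}4-\frac{6561x}{32})e_n+\frac{135}4e_{n+1}+e_{n+2}$, $A_2^{(n+2)}=-\frac{729}8e_n-\frac{27}2e_{n+1}$; $(\frac23,\frac13,\frac12,1)$: $A_1^{(n+2)}=(\frac{729}{16}-\frac{6561x}{32})e_n+\frac{27}2e_{n+1}+e_{n+2}$, $A_2^{(n+2)}=\frac{729}{16}e_n+\frac{27}4e_{n+1}$; $(\frac23,\frac43,1,\frac32)$: $A_1^{(n+2)}=-\frac{3645}{16}e_n+\frac{135}4e_{n+1}+e_{n+2}$, $A_2^{(n+2)}=\frac{729}4e_n-\frac{27}2e_{n+1}$; $(\frac43,\frac23,1,\frac32)$: $A_1^{(n+2)}=\frac{729}{16}e_n+\frac{27}2e_{n+1}+e_{n+2}$, $A_2^{(n+2)}=-\frac{729}8e_n+\frac{27}4e_{n+1}$; $(\frac43,\frac53,\frac32,2)$: $A_1^{(n+2)}=-\frac{729}8e_n+54e_{n+1}+e_{n+2}$, $A_2^{(n+2)}=-\frac{135}4e_{n+1}$; $(\frac53,\frac43,\frac32,2)$: $A_1^{(n+2)}=-\frac{729}8e_n-\frac{27}4e_{n+1}+e_{n+2}$, $A_2^{(n+2)}=27e_{n+1}$;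 $(\frac13,\frac23,1,\frac32)$: $A_1^{(n+2)}=-\frac{729}8e_n-\frac{27}4e_{n+1}+e_{n+2}$, $A_2^{(n+2)}=\frac{729}4e_n+27e_{n+1}$; $(\frac23,\frac13,1,\frac32)$: $A_1^{(n+2)}=\frac{729}{16}e_n+\frac{27}2e_{n+1}+e_{n+2}$, $A_2^{(n+2)}=\frac{729}{16}e_n+\frac{27}4e_{n+1}$; $(\frac23,\frac43,\frac32,2)$: $A_1^{(n+2)}=\frac{729}{16}e_n-\frac{189}4e_{n+1}+e_{n+2}$, $A_2^{(n+2)}=\frac{135}2e_{n+1}$; $(\frac43,\frac23,\frac32,2)$: $A_1^{(n+2)}=\frac{729}{16}e_n+\frac{27}2e_{n+1}+e_{n+2}$, $A_2^{(n+2)}=\frac{27}4e_{n+1}$; $(\frac43,\frac53,2,\frac52)$: $A_1^{(n+2)}=-\frac{27}2e_{n+1}+e_{n+2}$, $A_2^{(n+2)}=\frac{135}4e_{n+1}$; $(\frac53,\frac43,2,\frac52)$: $A_1^{(n+2)}=\frac{27}4e_{n+1}+e_{n+2}$, $A_2^{(n+2)}=\frac{27}2e_{n+1}$.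
   Context: The polynomials $e_n(x)$ are the coefficients of the formal power series $\frac{1}{(1+t/\kappa)^3-x\,t^2/\kappa^3}=\sum_{n\ge0}e_n(x)t^n$. For parameters $(a,b,c,d)$ put $\delta=c+d-a-b$ (all listed tuples satisfy $a,b,\delta>0$ and $d-a,d-b,c+1-a,c-b\notin\{0,-1,-2,\dots\}$). ${}_2F_1$ is the Gauss hypergeometric function. On $(0,1)$: $w_1(x)={}_2F_1(c-b,d-b;\delta;1-x)$, $w_2(x)=\frac cb{}_2F_1(c-b,d-b-1;\delta;1-x)$, $d\mu(x)=\frac{\Gamma(c)\Gamma(d)}{\Gamma(a)\Gamma(b)\Gamma(\delta)}x^{a-1}(1-x)^{\delta-1}dx$. For $N\ge0$, $A_1^{(N)},A_2^{(N)}$ are the unique polynomials with $\deg A_1^{(N)}\le\lfloor N/2\rfloor$, $\deg A_2^{(N)}\le\lfloor(N-1)/2\rfloor$ ($A_2^{(0)}=0$) such that $q^{(N)}=A_1^{(N)}w_1+A_2^{(N)}w_2$ satisfies $\int_0^1x^kq^{(N)}d\mu=0$ for $0\le k\le N-1$ and $\int_0^1x^Nq^{(N)}d\mu=1$. *)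

(* Defs.v *)
From Stdlib Require Import Reals Factorial.
From Coquelicot Require Import Coquelicot.
Open Scope R_scope.

Definition Gamma (s : R) : R :=
  RInt_gen (fun t => Rpower t (s - 1) * exp (- t)) (at_right 0) (Rbar_locally p_infty).

Fixpoint poch (q : R) (k : nat) : R :=
  match k with O => 1 | S k' => poch q k' * (q + INR k') end.

(* Gauss hypergeometric function 2F1(p,q;r;z) = sum_k (p)_k (q)_k / ((r)_k k!) z^k
   (used only for 0 < z < 1, where the series converges). *)
Definition F21 (p q r z : R) : R :=
  Series (fun k => poch p k * poch q k / (poch r k * INR (fact k)) * z ^ k).

(* The polynomials e_n(x): coefficients of the formal power series
   1 / ((1 + t/kappa)^3 - x t^2/kappa^3) = sum_n e_n(x) t^n.
   The denominator is D(t) = 1 + d1 t + d2 t^2 + d3 t^3 with the coefficients below;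
   since D(0) = 1, the coefficients of 1/D are determined by
   sum_{j} d_j e_{n-j} = [n = 0], i.e. e_n = - (d1 e_{n-1} + d2 e_{n-2} + d3 e_{n-3}). *)
Definition dcoef1 (kappa : R) (x : R) : R := 3 / kappa.
Definition dcoef2 (kappa : R) (x : R) : R := 3 / kappa ^ 2 - x / kappa ^ 3.
Definition dcoef3 (kappa : R) (x : R) : R := 1 / kappa ^ 3.

(* e_triple kappa n x = (e_n(x), e_{n-1}(x), e_{n-2}(x)) with e_{-1} = e_{-2} = 0 *)
Fixpoint e_triple (kappa : R) (n : nat) (x : R) : R * R * R :=
  match n with
  | O => (1, 0, 0)
  | S n' =>
      let '(e1, e2, e3) := e_triple kappa n' x in
      (- (dcoef1 kappa x * e1 + dcoef2 kappa x * e2 + dcoef3 kappa x * e3), e1, e2)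
  end.

Definition e (kappa : R) (n : nat) (x : R) : R := fst (fst (e_triple kappa n x)).

Definition poly_deg_le (m : nat) (f : R -> R) : Prop :=
  exists c : nat -> R, forall x, f x = sum_f_R0 (fun i => c i * x ^ i) m.

Definition delta (a b c d : R) : R := c + d - a - b.

Definition w1 (a b c d : R) (x : R) : R := F21 (c - b) (d - b) (delta a b c d) (1 - x).
Definition w2 (a b c d : R) (x : R) : R := c / b * F21 (c - b) (d - b - 1) (delta a b c d) (1 - x).

Definition mu_density (a b c d : R) (x : R) : R :=
  Gamma c * Gamma d / (Gamma a * Gamma b * Gamma (delta a b c d))
  * Rpower x (a - 1) * Rpower (1 - x) (delta a b c d - 1).

Definition mu_int_is (a b c d : R) (f : R -> R) (v : R) : Prop :=
  is_RInt_gen (fun x => f x * mu_density a b c d x) (at_right 0) (at_left 1) v.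

Definition typeI (a b c d : R) (N : nat) (A1 A2 : R -> R) : Prop :=
  poly_deg_le (Nat.div N 2) A1 /\
  (match N with
   | O => forall x, A2 x = 0
   | S N' => poly_deg_le (Nat.div N' 2) A2
   end) /\
  let q := fun x => A1 x * w1 a b c d x + A2 x * w2 a b c d x in
  (forall k : nat, (k < N)%nat -> mu_int_is a b c d (fun x => x ^ k * q x) 0) /\
  mu_int_is a b c d (fun x => x ^ N * q x) 1.

(* "A_1^{(n+2)} = P1 and A_2^{(n+2)} = P2": (P1,P2) is exactly the pair satisfying
   the defining conditions (existence and uniqueness of that pair). *)
Definition typeI_is (a b c d : R) (N : nat) (P1 P2 : R -> R) : Prop :=
  forall A1 A2 : R -> R,
    typeI a b c d N A1 A2 <-> ((forall x, A1 x = P1 x) /\ (forall x, A2 x = P2 x)).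

(* Main.v *)
(** The forms q^(N) = A_1^(N) w_1 + A_2^(N) w_2 are combinations, with coefficients independent of
    N, of e_(N-2), e_(N-1), e_N, so they inherit the recurrence of the e_n, which reads
    x q^(N+1) = kappa^3 q^(N+3) + 3 kappa^2 q^(N+2) + 3 kappa q^(N+1) + q^(N).  By induction on k
    all the orthogonality relations follow from int q^(N) dmu = [N = 0].  As w_1 dmu and w_2 dmu
    have the moments (a)_k (b)_k / ((c)_k (d)_k) and (a)_k (b+1)_k / ((c+1)_k (d)_k), this last
    relation is a hypergeometric sum, which telescopes.

    For the moments: d = c + 1/2 in all cases, so the 2F1 are even or odd parts of binomial series
    in s = sqrt (1 - x), and x = 4 y (1 - y) turns the moments into Beta integrals.  The constants
    only need B(p,q) = Gamma(p) Gamma(q) / Gamma(p+q) for p + q an integer, i.e. for p + q = 1.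

    Uniqueness: q^(0), ..., q^(N) have a unitriangular moment matrix and nonzero leading
    coefficients, alternately in A_1 and A_2, so they form a basis of the forms of index N. *)

Require Import Defs.
From Stdlib Require Import Reals Factorial ZArith Lra Lia.
From Coquelicot Require Import Coquelicot.
Open Scope R_scope.

(** Integration by parts shows that the ratio K of B(p,q) to Gamma(p) Gamma(q) / Gamma(p+q) does not
    change when p or q grows by 1. For p + q = 1, convexity bounds at p + n and 1 - p + n squeeze K
    to 1 as n tends to infinity, so no double integral occurs. This is why a and b are always
    written p + i and 1 - p + j.

    Integrals are carried as primitives with limits at both ends, which turns integration by parts
    and the substitution x = 4 y (1 - y) into differentiations.

    The condition int q^(N) dmu = [N = 0] has three regimes. N = 0 only says that w_1 dmu has mass
    1. N = 1 is a linear condition on the coefficients of e_(N-1), as e_1 = -3/kappa = -81/4. N >= 2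
    is a sum over the monomials of the e_k, whose telescoping amounts, for each tuple, to one
    identity of rational functions in N - 2 and the summation index, checked by [field]. *)

(** * Improper integrals through primitives *)

(* D is an open interval whose left and right ends are approached along Fa and Fb. *)
Record open_interval (D : R -> Prop) (Fa Fb : (R -> Prop) -> Prop) : Prop := {
  oi_left_proper : ProperFilter Fa;
  oi_right_proper : ProperFilter Fb;
  oi_open : forall x, D x -> locally x D;
  oi_convex : forall x y z, D x -> D y -> x <= z <= y -> D z;
  oi_left : forall z, D z -> Fa (fun x => D x /\ x < z);
  oi_right : forall z, D z -> Fb (fun x => D x /\ z < x);
  oi_inhabited : exists x, D x }.

(** Continuity is part of the notion because the fundamental theorem of calculus is applied to [f]
    when passing to the Riemann integral. *)
Definition newton_int (D : R -> Prop) (Fa Fb : (R -> Prop) -> Prop)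
    (f : R -> R) (v : R) : Prop :=
  (forall x, D x -> continuous f x) /\
  exists (F : R -> R) (la lb : R),
    (forall x, D x -> is_derive F x (f x)) /\
    filterlim F Fa (locally la) /\ filterlim F Fb (locally lb) /\ v = lb - la.

Lemma derive_increment (F f : R -> R) (a b : R) :
  a <= b -> (forall x, a <= x <= b -> is_derive F x (f x)) ->
  exists c, a <= c <= b /\ F b - F a = f c * (b - a).
Proof.
intros Hab HF.
destruct (MVT_gen F a b f) as [c [Hc E]].
- intros x Hx. apply HF. rewrite Rmin_left, Rmax_right in Hx by lra. lra.
- intros x Hx. rewrite Rmin_left, Rmax_right in Hx by lra.
  apply continuity_pt_filterlim. apply (ex_derive_continuous (V := R_NormedModule)).
  exists (f x). now apply HF.
- rewrite Rmin_left, Rmax_right in Hc by lra. now exists c.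
Qed.

Lemma filterlim_lin {T : Type} {F : (T -> Prop) -> Prop} {FF : Filter F}
    (f g : T -> R) (a b u v : R) :
  filterlim f F (locally u) -> filterlim g F (locally v) ->
  filterlim (fun x => a * f x + b * g x) F (locally (a * u + b * v)).
Proof.
intros Hf Hg.
apply (filterlim_comp_2 (fun x => a * f x) (fun x => b * g x) Rplus
  (G := locally (a * u)) (H := locally (b * v))).
- apply filterlim_comp with (1 := Hf). apply (filterlim_scal_r a u).
- apply filterlim_comp with (1 := Hg). apply (filterlim_scal_r b v).
- apply (filterlim_plus (a * u) (b * v)).
Qed.

Lemma newton_int_lin (D : R -> Prop) (Fa Fb : (R -> Prop) -> Prop) (f g : R -> R) (a b u v : R) :
  open_interval D Fa Fb -> newton_int D Fa Fb f u -> newton_int D Fa Fb g v ->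
  newton_int D Fa Fb (fun x => a * f x + b * g x) (a * u + b * v).
Proof.
intros HD [Cf [F [la [lb [dF [Fla [Flb ->]]]]]]] [Cg [G [ma [mb [dG [Gla [Glb ->]]]]]]].
destruct (oi_left_proper _ _ _ HD) as [_ FFa].
destruct (oi_right_proper _ _ _ HD) as [_ FFb].
split.
- intros x Dx.
  apply (continuous_plus (fun x => a * f x) (fun x => b * g x)).
  + apply (continuous_scal_r a f); auto.
  + apply (continuous_scal_r b g); auto.
- exists (fun x => a * F x + b * G x), (a * la + b * ma), (a * lb + b * mb).
  split; [|split; [|split]].
  + intros x Dx. apply (is_derive_plus (fun x => a * F x) (fun x => b * G x)).
    * apply (is_derive_scal F x a (f x)); auto.
    * apply (is_derive_scal G x b (g x)); auto.
  + now apply filterlim_lin.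
  + now apply filterlim_lin.
  + ring.
Qed.

Lemma newton_int_ext (D : R -> Prop) (Fa Fb : (R -> Prop) -> Prop) (f g : R -> R) (u v : R) :
  open_interval D Fa Fb -> (forall x, D x -> f x = g x) -> u = v ->
  newton_int D Fa Fb f u -> newton_int D Fa Fb g v.
Proof.
intros HD E <- [Cf [F [la [lb [dF H]]]]]. split.
- intros x Dx. apply continuous_ext_loc with f; [|auto].
  generalize (oi_open _ _ _ HD x Dx). apply filter_imp. exact E.
- exists F, la, lb. split; [|exact H].
  intros x Dx. rewrite <- E by auto. auto.
Qed.

Lemma newton_int_scal (D : R -> Prop) (Fa Fb : (R -> Prop) -> Prop) (f : R -> R) (a u : R) :
  open_interval D Fa Fb -> newton_int D Fa Fb f u ->
  newton_int D Fa Fb (fun x => a * f x) (a * u).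
Proof.
intros HD Hf.
apply newton_int_ext with (fun x => a * f x + 0 * f x) (a * u + 0 * u);
  [exact HD|intros; ring|ring|now apply newton_int_lin].
Qed.

Lemma newton_int_nondecreasing (D : R -> Prop) (Fa Fb : (R -> Prop) -> Prop) (F f : R -> R) (x y : R) :
  open_interval D Fa Fb -> (forall t, D t -> is_derive F t (f t)) ->
  (forall t, D t -> 0 <= f t) -> D x -> D y -> x <= y -> F x <= F y.
Proof.
intros HD dF Hf Dx Dy Hxy.
destruct (derive_increment F f x y Hxy) as [c [Hc E]].
- intros t Ht. apply dF. now apply (oi_convex _ _ _ HD x y).
- assert (0 <= f c) by (apply Hf; now apply (oi_convex _ _ _ HD x y)). nra.
Qed.

Lemma filterlim_ge {F : (R -> Prop) -> Prop} (FF : ProperFilter F) (f : R -> R) (l m : R) :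
  filterlim f F (locally l) -> F (fun x => m <= f x) -> m <= l.
Proof.
intros Hf Hm.
apply (filterlim_le (F := F) (fun _ => m) f m l Hm); [apply filterlim_const|exact Hf].
Qed.

Lemma filterlim_le_cst {F : (R -> Prop) -> Prop} (FF : ProperFilter F) (f : R -> R) (l m : R) :
  filterlim f F (locally l) -> F (fun x => f x <= m) -> l <= m.
Proof.
intros Hf Hm.
apply (filterlim_le (F := F) f (fun _ => m) l m Hm); [exact Hf|apply filterlim_const].
Qed.

(** A primitive of a nonnegative function increases, so its increment between inner points is at
    most the one between its limits. It is stated for every primitive [F], since the one inside
    [newton_int] is hidden by an existential. *)
Lemma newton_int_ge_increment (D : R -> Prop) (Fa Fb : (R -> Prop) -> Prop) (f : R -> R) (v : R) :
  open_interval D Fa Fb -> (forall x, D x -> 0 <= f x) -> newton_int D Fa Fb f v ->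
  forall F, (forall x, D x -> is_derive F x (f x)) ->
  forall x y, D x -> D y -> x <= y -> F y - F x <= v.
Proof.
intros HD Hf [_ [G [la [lb [dG [Gla [Glb ->]]]]]]] F dF x y Dx Dy Hxy.
assert (E : F y - F x = G y - G x).
{ destruct (derive_increment (fun t => F t - G t) (fun t => f t - f t) x y Hxy) as [c [_ E]].
  - intros t Ht. assert (D t) by now apply (oi_convex _ _ _ HD x y).
    apply (is_derive_minus F G); auto.
  - lra. }
assert (G y <= lb).
{ apply (filterlim_ge (oi_right_proper _ _ _ HD) G); [exact Glb|].
  generalize (oi_right _ _ _ HD y Dy). assert (Fi := oi_right_proper _ _ _ HD).
  apply filter_imp. intros t [Dt Ht].
  apply (newton_int_nondecreasing D Fa Fb G f); auto; lra. }
assert (la <= G x).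
{ apply (filterlim_le_cst (oi_left_proper _ _ _ HD) G); [exact Gla|].
  generalize (oi_left _ _ _ HD x Dx). assert (Fi := oi_left_proper _ _ _ HD).
  apply filter_imp. intros t [Dt Ht].
  apply (newton_int_nondecreasing D Fa Fb G f); auto; lra. }
lra.
Qed.

Lemma newton_int_nonneg (D : R -> Prop) (Fa Fb : (R -> Prop) -> Prop) (f : R -> R) (v : R) :
  open_interval D Fa Fb -> (forall x, D x -> 0 <= f x) -> newton_int D Fa Fb f v -> 0 <= v.
Proof.
intros HD Hf Hv. destruct (oi_inhabited _ _ _ HD) as [r Dr].
assert (Hv' := Hv). destruct Hv' as [_ [F [la [lb [dF _]]]]].
(* The increment from [r] to itself is 0, so this bound already reads 0 <= v. *)
assert (H := newton_int_ge_increment D Fa Fb f v HD Hf Hv F dF r r Dr Dr (Rle_refl r)).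
lra.
Qed.

Lemma newton_int_le (D : R -> Prop) (Fa Fb : (R -> Prop) -> Prop) (f g : R -> R) (u v : R) :
  open_interval D Fa Fb -> (forall x, D x -> f x <= g x) ->
  newton_int D Fa Fb f u -> newton_int D Fa Fb g v -> u <= v.
Proof.
intros HD H Hf Hg.
assert (0 <= 1 * v + (-1) * u); [|lra].
apply (newton_int_nonneg D Fa Fb (fun x => 1 * g x + (-1) * f x)); auto.
- intros x Dx. specialize (H x Dx). lra.
- now apply newton_int_lin.
Qed.

Lemma newton_int_pos (D : R -> Prop) (Fa Fb : (R -> Prop) -> Prop) (f : R -> R) (v : R) :
  open_interval D Fa Fb -> (forall x, D x -> 0 < f x) -> newton_int D Fa Fb f v -> 0 < v.
Proof.
intros HD Hf Hv. destruct (oi_inhabited _ _ _ HD) as [r Dr].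
assert (Hv' := Hv). destruct Hv' as [_ [F [la [lb [dF _]]]]].
destruct (oi_right_proper _ _ _ HD) as [Fex FF].
destruct (Fex _ (oi_right _ _ _ HD r Dr)) as [s [Ds Hs]].
assert (H : F s - F r <= v).
{ apply (newton_int_ge_increment D Fa Fb f v HD); auto; [|lra].
  intros x Dx. left; auto. }
destruct (derive_increment F f r s) as [c [Hc E]]; [lra| |].
- intros t Ht. apply dF. now apply (oi_convex _ _ _ HD r s).
- assert (0 < f c) by (apply Hf; now apply (oi_convex _ _ _ HD r s)). nra.
Qed.

(** Bridge to the integral of the statement: near the two ends both bounds lie in D, so the
    fundamental theorem applies on the whole segment between them. *)
Lemma newton_int_RInt_gen (D : R -> Prop) (Fa Fb : (R -> Prop) -> Prop) (f g : R -> R) (v : R) :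
  open_interval D Fa Fb -> (forall x, D x -> f x = g x) ->
  newton_int D Fa Fb f v -> is_RInt_gen g Fa Fb v.
Proof.
intros HD Efg [Cf [F [la [lb [dF [Fla [Flb ->]]]]]]].
destruct (oi_left_proper _ _ _ HD) as [_ FFa].
destruct (oi_right_proper _ _ _ HD) as [_ FFb].
destruct (oi_inhabited _ _ _ HD) as [r Dr].
assert (DD : filter_prod Fa Fb (fun ab => D (fst ab) /\ D (snd ab))).
{ apply Filter_prod with D D.
  - generalize (oi_left _ _ _ HD r Dr). apply filter_imp. tauto.
  - generalize (oi_right _ _ _ HD r Dr). apply filter_imp. tauto.
  - intros x y; simpl; tauto. }
assert (Dmid : forall a b x, D a -> D b -> Rmin a b <= x <= Rmax a b -> D x).
{ intros a b x Da Db Hx. destruct (Rle_or_lt a b).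
  - rewrite Rmin_left, Rmax_right in Hx by lra. now apply (oi_convex _ _ _ HD a b).
  - rewrite Rmin_right, Rmax_left in Hx by lra. now apply (oi_convex _ _ _ HD b a). }
apply is_RInt_gen_ext with f.
{ generalize DD. apply filter_imp. intros [a b] [Da Db] x Hx. simpl in *.
  apply Efg, (Dmid a b); auto. lra. }
assert (L : filterlim (fun ab => F (snd ab) - F (fst ab)) (filter_prod Fa Fb) (locally (lb - la))).
{ apply (filterlim_comp_2 (fun ab => F (snd ab)) (fun ab => F (fst ab)) Rminus
     (G := locally lb) (H := locally la)).
  - apply filterlim_comp with (2 := Flb). apply filterlim_snd.
  - apply filterlim_comp with (2 := Fla). apply filterlim_fst.
  - apply (filterlim_ext (fun z : R * R => plus (fst z) (opp (snd z)))); [reflexivity|].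
    apply (filterlim_comp_2 (fun z : R * R => fst z) (fun z : R * R => opp (snd z)) plus
      (G := locally lb) (H := locally (opp la))).
    + apply filterlim_fst.
    + apply filterlim_comp with (1 := filterlim_snd). apply (filterlim_opp la).
    + apply (filterlim_plus lb (opp la)). }
intros P HP.
assert (LP : filter_prod Fa Fb (fun ab => P (F (snd ab) - F (fst ab)))) by exact (L P HP).
unfold filtermapi. generalize (filter_and _ _ DD LP).
apply filter_imp. intros [a b] [[Da Db] Hab]. simpl in *.
exists (F b - F a). split; [|exact Hab].
apply (is_RInt_derive F f).
- intros x Hx. apply dF. now apply (Dmid a b).
- intros x Hx. apply Cf. now apply (Dmid a b).
Qed.

Lemma newton_int_exact (D : R -> Prop) (Fa Fb : (R -> Prop) -> Prop) (F f : R -> R) (la lb v : R) :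
  (forall x, D x -> continuous f x) -> (forall x, D x -> is_derive F x (f x)) ->
  filterlim F Fa (locally la) -> filterlim F Fb (locally lb) -> v = lb - la ->
  newton_int D Fa Fb f v.
Proof. intros C dF Fla Flb E. split; [exact C|]. now exists F, la, lb. Qed.

Lemma monotone_limit_right (D : R -> Prop) (Fa Fb : (R -> Prop) -> Prop) (F : R -> R) (M : R) :
  open_interval D Fa Fb -> (forall x y, D x -> D y -> x <= y -> F x <= F y) ->
  (forall x, D x -> F x <= M) -> exists l, filterlim F Fb (locally l).
Proof.
intros HD Hinc HM. destruct (oi_right_proper _ _ _ HD) as [_ FFb].
destruct (oi_inhabited _ _ _ HD) as [r Dr].
destruct (completeness (fun y => exists x, D x /\ y = F x)) as [l [Hub Hl]].
- exists M. intros y [x [Dx ->]]. auto.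
- now exists (F r), r.
- exists l. apply filterlim_locally. intros eps.
  assert (exists z, D z /\ l - eps < F z) as [z [Dz Hz]].
  { apply Classical_Prop.NNPP. intros N.
    assert (l <= l - eps); [|destruct eps; simpl in *; lra].
    apply Hl. intros y [x [Dx ->]]. apply Rnot_lt_le. intros C. apply N. now exists x. }
  generalize (oi_right _ _ _ HD z Dz). apply filter_imp. intros x [Dx Hx].
  assert (F x <= l) by (apply Hub; now exists x).
  assert (F z <= F x) by (apply Hinc; auto; lra).
  change (Rabs (F x - l) < eps). apply Rabs_def1; destruct eps; simpl in *; lra.
Qed.

Lemma monotone_limit_left (D : R -> Prop) (Fa Fb : (R -> Prop) -> Prop) (F : R -> R) (m : R) :
  open_interval D Fa Fb -> (forall x y, D x -> D y -> x <= y -> F x <= F y) ->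
  (forall x, D x -> m <= F x) -> exists l, filterlim F Fa (locally l).
Proof.
intros HD Hinc HM. destruct (oi_left_proper _ _ _ HD) as [_ FFa].
destruct (oi_inhabited _ _ _ HD) as [r Dr].
destruct (completeness (fun y => exists x, D x /\ y = - F x)) as [l [Hub Hl]].
- exists (-m). intros y [x [Dx ->]]. specialize (HM x Dx). lra.
- now exists (- F r), r.
- exists (- l). apply filterlim_locally. intros eps.
  assert (exists z, D z /\ l - eps < - F z) as [z [Dz Hz]].
  { apply Classical_Prop.NNPP. intros N.
    assert (l <= l - eps); [|destruct eps; simpl in *; lra].
    apply Hl. intros y [x [Dx ->]]. apply Rnot_lt_le. intros C. apply N. now exists x. }
  generalize (oi_left _ _ _ HD z Dz). apply filter_imp. intros x [Dx Hx].
  assert (- F x <= l) by (apply Hub; now exists x).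
  assert (F x <= F z) by (apply Hinc; auto; lra).
  change (Rabs (F x - - l) < eps). apply Rabs_def1; destruct eps; simpl in *; lra.
Qed.

(** With F a primitive of f, both F and G - F are nondecreasing. Hence F varies by at most the
    variation of G, which is at most 2 M, and bounded monotone functions have limits at both
    ends. *)
Lemma newton_int_dominated (D : R -> Prop) (Fa Fb : (R -> Prop) -> Prop) (f g G : R -> R) (M : R) :
  open_interval D Fa Fb -> (forall x, D x -> continuous f x) ->
  (forall x, D x -> 0 <= f x <= g x) -> (forall x, D x -> is_derive G x (g x)) ->
  (forall x, D x -> Rabs (G x) <= M) -> exists v, newton_int D Fa Fb f v.
Proof.
intros HD Cf Hfg dG HM. destruct (oi_inhabited _ _ _ HD) as [r Dr].
assert (Dmid : forall a x, D a -> Rmin r a <= x <= Rmax r a -> D x).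
{ intros a x Da Hx. destruct (Rle_or_lt r a).
  - rewrite Rmin_left, Rmax_right in Hx by lra. now apply (oi_convex _ _ _ HD r a).
  - rewrite Rmin_right, Rmax_left in Hx by lra. now apply (oi_convex _ _ _ HD a r). }
set (F := fun x => RInt f r x).
assert (dF : forall x, D x -> is_derive F x (f x)).
{ intros x Dx. apply (is_derive_RInt f F r x); [|now apply Cf].
  generalize (oi_open _ _ _ HD x Dx). apply filter_imp. intros y Dy.
  apply (RInt_correct f r y), ex_RInt_continuous. intros z Hz. now apply Cf, (Dmid y). }
assert (Finc : forall x y, D x -> D y -> x <= y -> F x <= F y).
{ intros x y Dx Dy Hxy. apply (newton_int_nondecreasing D Fa Fb F f); auto.
  intros t Dt. now apply Hfg. }
assert (GFinc : forall x y, D x -> D y -> x <= y -> G x - F x <= G y - F y).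
{ intros x y Dx Dy Hxy.
  apply (newton_int_nondecreasing D Fa Fb (fun t => G t - F t) (fun t => g t - f t)); auto.
  - intros t Dt. apply (is_derive_minus G F); auto.
  - intros t Dt. specialize (Hfg t Dt). lra. }
assert (Bd : forall x, D x -> Rabs (F x - F r) <= 2 * M).
{ intros x Dx. assert (H1 := HM x Dx). assert (H2 := HM r Dr).
  apply Rabs_le_between in H1, H2. apply Rabs_le.
  destruct (Rle_or_lt r x) as [H|H].
  - specialize (Finc r x Dr Dx H). specialize (GFinc r x Dr Dx H). lra.
  - specialize (Finc x r Dx Dr (Rlt_le _ _ H)). specialize (GFinc x r Dx Dr (Rlt_le _ _ H)). lra. }
destruct (monotone_limit_right D Fa Fb F (F r + 2 * M) HD Finc) as [lb Hlb].
{ intros x Dx. specialize (Bd x Dx). apply Rabs_le_between in Bd. lra. }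
destruct (monotone_limit_left D Fa Fb F (F r - 2 * M) HD Finc) as [la Hla].
{ intros x Dx. specialize (Bd x Dx). apply Rabs_le_between in Bd. lra. }
exists (lb - la). now apply newton_int_exact with F la lb.
Qed.

Lemma open_interval_01 : open_interval (fun x => 0 < x < 1) (at_right 0) (at_left 1).
Proof.
split.
- apply at_right_proper_filter.
- apply at_left_proper_filter.
- intros x [H0 H1]. apply filter_and; [now apply open_gt|now apply open_lt].
- intros; lra.
- intros z [H0 H1]. unfold at_right, within.
  apply (filter_imp (fun x => x < z)); [intros; lra|now apply open_lt].
- intros z [H0 H1]. unfold at_left, within.
  apply (filter_imp (fun x => z < x)); [intros; lra|now apply open_gt].
- exists (1/2). lra.
Qed.

Lemma open_interval_0_infty :
  open_interval (fun x => 0 < x) (at_right 0) (Rbar_locally p_infty).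
Proof.
split.
- apply at_right_proper_filter.
- apply Rbar_locally_filter.
- intros x H0. now apply open_gt.
- intros; lra.
- intros z H0. unfold at_right, within.
  apply (filter_imp (fun x => x < z)); [intros; lra|now apply open_lt].
- intros z H0. exists z. intros; lra.
- exists 1. lra.
Qed.

(** * Gamma and Beta integrals *)

Definition gamma_int (s v : R) : Prop :=
  newton_int (fun t => 0 < t) (at_right 0) (Rbar_locally p_infty)
    (fun t => Rpower t (s - 1) * exp (- t)) v.

Definition beta_int (p q v : R) : Prop :=
  newton_int (fun x => 0 < x < 1) (at_right 0) (at_left 1)
    (fun x => Rpower x (p - 1) * Rpower (1 - x) (q - 1)) v.

Lemma Rpower_gt_0 (x y : R) : 0 < Rpower x y.
Proof. apply exp_pos. Qed.

Lemma Rpower_plus_1 (x y : R) : 0 < x -> Rpower x (y + 1) = x * Rpower x y.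
Proof. intros Hx. rewrite Rpower_plus, Rpower_1 by assumption. ring. Qed.

Lemma Rpower_minus_1 (x y : R) : 0 < x -> Rpower x y = x * Rpower x (y - 1).
Proof. intros Hx. rewrite <- Rpower_plus_1 by assumption. f_equal. ring. Qed.

Lemma is_derive_Rpower (x y : R) :
  0 < x -> is_derive (fun t => Rpower t y) x (y * Rpower x (y - 1)).
Proof. intros Hx. apply is_derive_Reals. now apply derivable_pt_lim_power. Qed.

Lemma is_derive_Rpower_compl (x y : R) :
  x < 1 -> is_derive (fun t => Rpower (1 - t) y) x (- (y * Rpower (1 - x) (y - 1))).
Proof.
intros Hx.
evar_last.
- apply (is_derive_comp (fun t => Rpower t y) (fun t => 1 - t) x).
  + apply is_derive_Rpower. lra.
  + instantiate (1 := -1). auto_derive; [exact I|ring].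
- unfold scal; simpl; unfold mult; simpl. ring.
Qed.

Lemma continuous_Rpower (x y : R) : 0 < x -> continuous (fun t => Rpower t y) x.
Proof.
intros Hx. apply (ex_derive_continuous (V := R_NormedModule)).
eexists. now apply is_derive_Rpower.
Qed.

Lemma continuous_Rpower_compl (x y : R) : x < 1 -> continuous (fun t => Rpower (1 - t) y) x.
Proof.
intros Hx. apply (ex_derive_continuous (V := R_NormedModule)).
eexists. now apply is_derive_Rpower_compl.
Qed.

Lemma Rpower_lim_0 (p : R) : 0 < p -> filterlim (fun x => Rpower x p) (at_right 0) (locally 0).
Proof.
intros Hp. apply filterlim_locally. intros eps. unfold at_right, within.
assert (He : 0 < Rpower eps (1 / p)) by apply Rpower_gt_0.
apply (filter_imp (fun x => x < Rpower eps (1 / p))); [|now apply open_lt].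
intros x Hx H0. change (Rabs (Rpower x p - 0) < eps).
rewrite Rminus_0_r, Rabs_pos_eq by (left; apply Rpower_gt_0).
replace (pos eps) with (Rpower (Rpower eps (1 / p)) p).
- apply Rlt_Rpower_l; lra.
- rewrite Rpower_mult. replace (1 / p * p) with 1 by (field; lra).
  apply Rpower_1, cond_pos.
Qed.

Lemma compl_lim_left_1 : filterlim (fun x => 1 - x) (at_left 1) (at_right 0).
Proof.
intros P HP. unfold filtermap, at_left, at_right, within in *.
destruct HP as [eps HP]. exists eps. intros x Hx H1. apply HP; [|lra].
change (Rabs (x - 1) < eps) in Hx. change (Rabs (1 - x - 0) < eps).
rewrite <- Rabs_Ropp. replace (- (1 - x - 0)) with (x - 1) by ring. exact Hx.
Qed.

Lemma compl_lim_right_0 : filterlim (fun x => 1 - x) (at_right 0) (at_left 1).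
Proof.
intros P HP. unfold filtermap, at_left, at_right, within in *.
destruct HP as [eps HP]. exists eps. intros x Hx H1. apply HP; [|lra].
change (Rabs (x - 0) < eps) in Hx. change (Rabs (1 - x - 1) < eps).
rewrite <- Rabs_Ropp. replace (- (1 - x - 1)) with (x - 0) by ring. exact Hx.
Qed.

Lemma filterlim_mult_R {T : Type} {F : (T -> Prop) -> Prop} {FF : Filter F}
    (f g : T -> R) (u v : R) :
  filterlim f F (locally u) -> filterlim g F (locally v) ->
  filterlim (fun x => f x * g x) F (locally (u * v)).
Proof.
intros Hf Hg. apply (filterlim_comp_2 f g Rmult (G := locally u) (H := locally v)); auto.
apply (filterlim_mult (K := R_AbsRing) u v).
Qed.

(** The integrand is the derivative of x^p (1 - x)^q, which vanishes at both ends. This is the only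
    integration by parts needed for the Beta function. *)
Lemma beta_exact (p q : R) : 0 < p -> 0 < q ->
  newton_int (fun x => 0 < x < 1) (at_right 0) (at_left 1)
    (fun x => Rpower x (p - 1) * Rpower (1 - x) (q - 1) * (p * (1 - x) - q * x)) 0.
Proof.
intros Hp Hq.
apply newton_int_exact with (fun x => Rpower x p * Rpower (1 - x) q)
  (0 * Rpower (1 - 0) q) (Rpower 1 p * 0).
- intros x Hx. apply (continuous_mult (K := R_AbsRing)
    (fun x => Rpower x (p - 1) * Rpower (1 - x) (q - 1))).
  + apply (continuous_mult (K := R_AbsRing)).
    * apply continuous_Rpower; lra.
    * apply continuous_Rpower_compl; lra.
  + apply (ex_derive_continuous (V := R_NormedModule)). auto_derive. exact I.
- intros x Hx.
  evar_last; [apply (is_derive_mult (K := R_AbsRing) (fun x => Rpower x p) (fun x => Rpower (1 - x) q))|].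
  + apply is_derive_Rpower; lra.
  + apply is_derive_Rpower_compl; lra.
  + intros; apply Rmult_comm.
  + rewrite (Rpower_minus_1 x p), (Rpower_minus_1 (1 - x) q) by lra.
    unfold plus, mult; simpl. ring.
- apply filterlim_mult_R.
  + now apply Rpower_lim_0.
  + apply (filterlim_filter_le_1 (F := locally 0)); [apply filter_le_within|].
    apply continuous_Rpower_compl. lra.
- apply filterlim_mult_R.
  + apply (filterlim_filter_le_1 (F := locally 1)); [apply filter_le_within|].
    apply continuous_Rpower. lra.
  + apply (filterlim_comp _ _ _ (fun x => 1 - x) (fun y => Rpower y q) _ (at_right 0)); [exact compl_lim_left_1|]. now apply Rpower_lim_0.
- ring.
Qed.

(** Since (p + q) x = p - (p (1 - x) - q x), the new integrand is a combination of the old one and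
    the exact one. *)
Lemma beta_int_Sl (p q v : R) : 0 < p -> 0 < q ->
  beta_int p q v -> beta_int (p + 1) q (p / (p + q) * v).
Proof.
intros Hp Hq H.
apply newton_int_ext with (4 := newton_int_lin _ _ _ _ _ (p / (p + q)) (- / (p + q)) _ _
  open_interval_01 H (beta_exact p q Hp Hq)).
- exact open_interval_01.
- intros x Hx. replace (p + 1 - 1) with p by ring.
  rewrite (Rpower_minus_1 x p) by lra. field. lra.
- ring.
Qed.

Lemma beta_int_Sr (p q v : R) : 0 < p -> 0 < q ->
  beta_int p q v -> beta_int p (q + 1) (q / (p + q) * v).
Proof.
intros Hp Hq H.
apply newton_int_ext with (4 := newton_int_lin _ _ _ _ _ 1 (-1) _ _
  open_interval_01 H (beta_int_Sl p q v Hp Hq H)).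
- exact open_interval_01.
- intros x Hx. replace (p + 1 - 1) with p by ring. replace (q + 1 - 1) with q by ring.
  rewrite (Rpower_minus_1 x p), (Rpower_minus_1 (1 - x) q) by lra. ring.
- field. lra.
Qed.

Lemma exp_le_compat (x y : R) : x <= y -> exp x <= exp y.
Proof. intros [H| ->]; [left; now apply exp_increasing|right; reflexivity]. Qed.

(* From ln y <= y - 1 at y = t / (2 s): t^s e^(-t) is O(e^(-t/2)). *)
Lemma Rpower_exp_lim_infty (s : R) : 0 < s ->
  filterlim (fun t => Rpower t s * exp (- t)) (Rbar_locally p_infty) (locally 0).
Proof.
intros Hs.
set (C := exp (s * ln (2 * s) - s)).
change (filterlim (fun t => Rpower t s * exp (- t)) (Rbar_locally p_infty) (Rbar_locally (Finite 0))).
apply filterlim_le_le with (f := fun _ => 0) (h := fun t => C * exp (- (t / 2))).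
- exists 0. intros t Ht. split.
  + left. apply Rmult_lt_0_compat; apply exp_pos.
  + unfold C, Rpower. rewrite <- !exp_plus. apply exp_le_compat.
    assert (0 < t / (2 * s)) by (apply Rdiv_lt_0_compat; lra).
    assert (H1 : ln (t / (2 * s)) <= t / (2 * s) - 1).
    { generalize (exp_ineq1_le (ln (t / (2 * s)))). rewrite exp_ln by assumption. lra. }
    rewrite ln_div in H1 by lra.
    apply Rmult_le_compat_l with (r := s) in H1; [|lra].
    replace (s * (t / (2 * s) - 1)) with (t / 2 - s) in H1 by (field; lra). lra.
- apply (filterlim_const (F := Rbar_locally p_infty) 0).
- simpl. rewrite <- (Rmult_0_r C).
  apply (filterlim_comp _ _ _ (fun t => exp (- (t / 2))) (fun y => C * y) _ (locally 0)); [|apply (filterlim_scal_r C 0)].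
  apply (filterlim_comp _ _ _ (fun t => - (t / 2)) exp _ (Rbar_locally m_infty)); [|apply is_lim_exp_m].
  intros P [M HP]. exists (- 2 * M). intros x Hx. apply HP. lra.
Qed.

Lemma gamma_exact (s : R) : 0 < s ->
  newton_int (fun t => 0 < t) (at_right 0) (Rbar_locally p_infty)
    (fun t => Rpower t (s - 1) * exp (- t) * (s - t)) 0.
Proof.
intros Hs.
apply newton_int_exact with (fun t => Rpower t s * exp (- t)) (0 * exp (- 0)) 0.
- intros x Hx. apply (continuous_mult (K := R_AbsRing) (fun t => Rpower t (s - 1) * exp (- t))).
  + apply (continuous_mult (K := R_AbsRing)).
    * apply continuous_Rpower; lra.
    * apply (ex_derive_continuous (V := R_NormedModule)). auto_derive. exact I.
  + apply (ex_derive_continuous (V := R_NormedModule)). auto_derive. exact I.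
- intros x Hx.
  evar_last; [apply (is_derive_mult (K := R_AbsRing) (fun x => Rpower x s) (fun x => exp (- x)))|].
  + apply is_derive_Rpower; lra.
  + auto_derive; [exact I|reflexivity].
  + intros; apply Rmult_comm.
  + rewrite (Rpower_minus_1 x s) by lra. unfold plus, mult; simpl. ring.
- apply filterlim_mult_R.
  + now apply Rpower_lim_0.
  + apply (filterlim_filter_le_1 (F := locally 0)); [apply filter_le_within|].
    apply (ex_derive_continuous (V := R_NormedModule) (fun x => exp (- x))). auto_derive. exact I.
- now apply Rpower_exp_lim_infty.
- ring.
Qed.

Lemma gamma_int_S (s v : R) : 0 < s -> gamma_int s v -> gamma_int (s + 1) (s * v).
Proof.
intros Hs H.
apply newton_int_ext with (4 := newton_int_lin _ _ _ _ _ s (-1) _ _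
  open_interval_0_infty H (gamma_exact s Hs)).
- exact open_interval_0_infty.
- intros x Hx. replace (s + 1 - 1) with s by ring.
  rewrite (Rpower_minus_1 x s) by lra. ring.
- ring.
Qed.

(** From e^(t/2) >= 1 + t/2 follows e^(-t) <= 4 (1 + t)^(-2), which is at most 4 (1 + t)^(-s-1) as s
    <= 1. The resulting bound is the derivative of (4/s) (t / (1 + t))^s, so a single bounded
    primitive controls both ends. *)
Lemma gamma_int_exists_le_1 (s : R) : 0 < s <= 1 -> exists v, gamma_int s v.
Proof.
intros Hs.
apply newton_int_dominated with
  (g := fun t => 4 * (Rpower t (s - 1) * Rpower (1 + t) (- s - 1)))
  (G := fun t => 4 / s * (Rpower t s * Rpower (1 + t) (- s))) (M := 4 / s).
- exact open_interval_0_infty.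
- intros x Hx. apply (continuous_mult (K := R_AbsRing)).
  + apply continuous_Rpower; lra.
  + apply (ex_derive_continuous (V := R_NormedModule)). auto_derive. exact I.
- intros x Hx. assert (Hp := Rpower_gt_0 x (s - 1)). split.
  { left. apply Rmult_lt_0_compat; [assumption|apply exp_pos]. }
  rewrite <- Rmult_assoc, (Rmult_comm 4), Rmult_assoc. apply Rmult_le_compat_l; [lra|].
  apply Rle_trans with (4 * Rpower (1 + x) (- INR 2)).
  + rewrite Rpower_Ropp, Rpower_pow by lra. rewrite exp_Ropp.
    assert (H : 1 + x / 2 <= exp (x / 2)) by apply exp_ineq1_le.
    assert (E : exp x = exp (x / 2) * exp (x / 2)) by (rewrite <- exp_plus; f_equal; field).
    rewrite E. apply Rmult_le_reg_l with (exp (x / 2) * exp (x / 2)).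
    { apply Rmult_lt_0_compat; apply exp_pos. }
    rewrite Rinv_r by (apply Rgt_not_eq, Rmult_lt_0_compat; apply exp_pos).
    apply Rmult_le_reg_r with ((1 + x) ^ 2); [nra|].
    replace (exp (x / 2) * exp (x / 2) * (4 * / (1 + x) ^ 2) * (1 + x) ^ 2)
      with (4 * (exp (x / 2) * exp (x / 2))) by (field; lra).
    nra.
  + apply Rmult_le_compat_l; [lra|]. apply Rle_Rpower; simpl; lra.
- intros x Hx.
  evar_last.
  + apply is_derive_scal.
    apply (is_derive_mult (K := R_AbsRing) (fun t => Rpower t s) (fun t => Rpower (1 + t) (- s))).
    * apply is_derive_Rpower; lra.
    * evar_last.
      -- apply (is_derive_comp (fun t => Rpower t (- s)) (fun t => 1 + t) x).
         ++ apply is_derive_Rpower. lra.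
         ++ instantiate (1 := 1). auto_derive; [exact I|ring].
      -- reflexivity.
    * intros; apply Rmult_comm.
  + unfold plus, mult, scal; simpl; unfold mult; simpl.
    rewrite (Rpower_minus_1 x s), (Rpower_minus_1 (1 + x) (- s)) by lra.
    field. lra.
- intros x Hx. rewrite Rpower_Ropp.
  assert (H0 := Rpower_gt_0 x s). assert (H1 := Rpower_gt_0 (1 + x) s).
  assert (H2 : Rpower x s <= Rpower (1 + x) s) by (apply Rle_Rpower_l; lra).
  assert (H3 : 0 < 4 / s) by (apply Rdiv_lt_0_compat; lra).
  assert (H4 : 0 < / Rpower (1 + x) s) by now apply Rinv_0_lt_compat.
  rewrite Rabs_pos_eq by (repeat apply Rmult_le_pos; lra).
  rewrite <- (Rmult_1_r (4 / s)) at 2. apply Rmult_le_compat_l; [lra|].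
  apply Rmult_le_reg_r with (Rpower (1 + x) s); [assumption|].
  rewrite Rmult_assoc, Rinv_l by lra. lra.
Qed.

Lemma gamma_int_exists (s : R) : 0 < s -> exists v, gamma_int s v.
Proof.
intros Hs.
destruct (nfloor_ex s) as [n Hn]; [lra|].
revert s Hs Hn. induction n as [|n IH]; intros s Hs Hn.
- apply gamma_int_exists_le_1. simpl in Hn. lra.
- rewrite S_INR in Hn. destruct (Rle_lt_dec s 1) as [H1|H1].
  + apply gamma_int_exists_le_1. lra.
  + destruct (IH (s - 1)) as [v Hv]; [lra|lra|].
    exists ((s - 1) * v). replace s with (s - 1 + 1) at 1 by ring.
    apply gamma_int_S; [lra|assumption].
Qed.

Lemma gamma_int_unique (s v : R) : gamma_int s v -> Gamma s = v.
Proof.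
intros H. apply is_RInt_gen_unique.
apply newton_int_RInt_gen with (3 := H); [exact open_interval_0_infty|reflexivity].
Qed.

Lemma gamma_int_Gamma (s : R) : 0 < s -> gamma_int s (Gamma s).
Proof.
intros Hs. destruct (gamma_int_exists s Hs) as [v Hv].
now rewrite (gamma_int_unique s v Hv).
Qed.

Lemma Gamma_pos (s : R) : 0 < s -> 0 < Gamma s.
Proof.
intros Hs.
apply (newton_int_pos _ _ _ _ _ open_interval_0_infty) with (2 := gamma_int_Gamma s Hs).
intros x Hx. apply Rmult_lt_0_compat; apply exp_pos.
Qed.

Lemma Gamma_S (s : R) : 0 < s -> Gamma (s + 1) = s * Gamma s.
Proof. intros Hs. apply gamma_int_unique, gamma_int_S, gamma_int_Gamma; assumption. Qed.

Lemma Gamma_1 : Gamma 1 = 1.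
Proof.
apply gamma_int_unique.
apply newton_int_ext with (f := fun t => exp (- t)) (u := 0 - (- 1)).
- exact open_interval_0_infty.
- intros x Hx. replace (1 - 1) with 0 by ring. rewrite Rpower_O by assumption. ring.
- ring.
- apply newton_int_exact with (fun t => - exp (- t)) (- 1) 0.
  + intros x _. apply (ex_derive_continuous (V := R_NormedModule)). auto_derive. exact I.
  + intros x _. auto_derive; [exact I|ring].
  + replace (-1) with (- exp (- 0)) by (rewrite Ropp_0, exp_0; reflexivity).
    apply (filterlim_filter_le_1 (F := locally 0)); [apply filter_le_within|].
    apply (ex_derive_continuous (V := R_NormedModule) (fun x => - exp (- x))). auto_derive. exact I.
  + replace 0 with (-1 * 0) by ring.
    apply (filterlim_ext (fun t => -1 * exp (- t))); [intros; ring|].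
    apply (filterlim_comp _ _ _ (fun t => exp (- t)) (fun y => -1 * y) _ (locally 0)); [|apply (filterlim_scal_r (-1) 0)].
    apply (filterlim_comp _ _ _ (fun t => - t) exp _ (Rbar_locally m_infty)); [|apply is_lim_exp_m].
    apply (filterlim_Rbar_opp p_infty).
  + ring.
Qed.

(** On each half of (0,1) one of the two factors is at most 2, so the integrand is at most twice the
    sum of the two factors, whose primitive is bounded. *)
Lemma beta_int_exists (p q : R) : 0 < p <= 1 -> 0 < q <= 1 -> exists v, beta_int p q v.
Proof.
intros Hp Hq.
assert (B2 : forall x r, 1/2 <= x -> 0 < r <= 1 -> Rpower x (r - 1) <= 2).
{ intros x r Hx Hr. replace (r - 1) with (- (1 - r)) by ring. rewrite Rpower_Ropp.
  replace 2 with (/ (1/2)) by lra. apply Rinv_le_contravar; [lra|].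
  apply Rle_trans with (Rpower (1/2) (1 - r)).
  - apply Rle_trans with (Rpower (1/2) 1); [rewrite Rpower_1; lra|].
    unfold Rpower. apply exp_le_compat.
    assert (ln (1/2) < 0) by (rewrite <- ln_1; apply ln_increasing; lra). nra.
  - apply Rle_Rpower_l; lra. }
apply newton_int_dominated with
  (g := fun x => 2 * (Rpower x (p - 1) + Rpower (1 - x) (q - 1)))
  (G := fun x => 2 * (Rpower x p / p - Rpower (1 - x) q / q)) (M := 2 * (/ p + / q)).
- exact open_interval_01.
- intros x Hx. apply (continuous_mult (K := R_AbsRing)).
  + apply continuous_Rpower; lra.
  + apply continuous_Rpower_compl; lra.
- intros x Hx. assert (H0 := Rpower_gt_0 x (p - 1)). assert (H1 := Rpower_gt_0 (1 - x) (q - 1)).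
  destruct (Rle_lt_dec x (1/2)).
  + assert (H := B2 (1 - x) q ltac:(lra) Hq). nra.
  + assert (H := B2 x p ltac:(lra) Hp). nra.
- intros x Hx. evar_last.
  + apply is_derive_scal.
    apply (is_derive_minus (fun x => Rpower x p / p) (fun x => Rpower (1 - x) q / q)).
    * apply (is_derive_ext (fun x => / p * Rpower x p)); [intros t; apply Rmult_comm|].
      apply is_derive_scal, is_derive_Rpower; lra.
    * apply (is_derive_ext (fun x => / q * Rpower (1 - x) q)); [intros t; apply Rmult_comm|].
      apply is_derive_scal, is_derive_Rpower_compl; lra.
  + unfold minus, plus, opp, mult, scal; simpl. field. lra.
- intros x Hx.
  assert (B1 : forall y r, 0 < y < 1 -> 0 < r <= 1 -> 0 <= Rpower y r / r <= / r).
  { intros y r Hy Hr. assert (H1 := Rpower_gt_0 y r).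
    assert (H2 : Rpower y r <= Rpower 1 r) by (apply Rle_Rpower_l; lra).
    replace (Rpower 1 r) with 1 in H2 by (unfold Rpower; rewrite ln_1, Rmult_0_r, exp_0; reflexivity).
    assert (0 < / r) by (apply Rinv_0_lt_compat; lra). unfold Rdiv. split; nra. }
  assert (H1 := B1 x p ltac:(lra) Hp). assert (H2 := B1 (1 - x) q ltac:(lra) Hq).
  apply Rabs_le. lra.
Qed.

(** * Convexity bounds and the value of the Beta integral *)

Lemma Rpower_bernoulli (y p : R) : 0 < y -> 0 <= p <= 1 -> Rpower y p <= 1 + p * (y - 1).
Proof.
intros Hy Hp. set (z := ln y).
assert (E : y = exp z) by (symmetry; now apply exp_ln).
unfold Rpower. fold z.
assert (H1 := exp_ineq1_le ((1 - p) * z)). assert (H2 := exp_ineq1_le (- (p * z))).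
assert (H0 := exp_pos (p * z)).
assert (E1 : exp (p * z) * exp ((1 - p) * z) = y).
{ rewrite E, <- exp_plus. f_equal. ring. }
assert (E2 : exp (p * z) * exp (- (p * z)) = 1).
{ rewrite <- exp_plus, <- exp_0. f_equal. ring. }
(* Convexity of exp, by tangents at p z: with weights p and 1 - p the linear terms p (1 - p) z of
   [H1] and [H2] cancel, leaving e^(pz) <= p e^z + 1 - p. *)
apply Rmult_le_compat_l with (r := p * exp (p * z)) in H1; [|nra].
apply Rmult_le_compat_l with (r := (1 - p) * exp (p * z)) in H2; [|nra].
replace (p * exp (p * z) * exp ((1 - p) * z)) with (p * y) in H1 by (rewrite <- E1; ring).
replace ((1 - p) * exp (p * z) * exp (- (p * z))) with (1 - p) in H2
  by (rewrite Rmult_assoc, E2; ring).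
lra.
Qed.

Lemma Rpower_opp_bernoulli (y p : R) : 0 < y -> 0 <= p <= 1 -> 1 - p * (y - 1) <= Rpower y (- p).
Proof.
intros Hy Hp. rewrite Rpower_Ropp.
assert (H := Rpower_bernoulli y p Hy Hp). assert (H0 := Rpower_gt_0 y p).
apply Rmult_le_reg_l with (Rpower y p); [assumption|]. rewrite Rinv_r by lra.
set (u := p * (y - 1)) in *. destruct (Rle_lt_dec (1 - u) 0) as [Hu|Hu]; [nra|].
apply Rle_trans with ((1 + u) * (1 - u)); [|nra].
apply Rmult_le_compat_r; lra.
Qed.

Lemma gamma_integrand_shift (nu p t : R) : 0 < nu -> 0 < t ->
  Rpower t (nu + p - 1) = Rpower t (nu - 1) * (Rpower nu p * Rpower (t / nu) p).
Proof.
intros Hnu Ht. rewrite Rpower_mult_distr; [|lra|now apply Rdiv_lt_0_compat].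
replace (nu * (t / nu)) with t by (field; lra).
rewrite <- Rpower_plus. f_equal. ring.
Qed.

(** Bernoulli's inequality at y = t / nu, integrated against t^(nu-1) e^(-t). The mean of t / nu for
    this weight is 1, so the correction p (y - 1) integrates to 0. *)
Lemma Gamma_shift_le (nu p : R) : 0 < nu -> 0 <= p <= 1 ->
  Gamma (nu + p) <= Rpower nu p * Gamma nu.
Proof.
intros Hnu Hp.
assert (G0 := gamma_int_Gamma nu Hnu).
assert (G1 := gamma_int_S nu _ Hnu G0).
assert (G2 := newton_int_lin _ _ _ _ _ (Rpower nu p * (1 - p)) (Rpower nu p * (p / nu)) _ _
  open_interval_0_infty G0 G1).
replace (Rpower nu p * Gamma nu) with
  (Rpower nu p * (1 - p) * Gamma nu + Rpower nu p * (p / nu) * (nu * Gamma nu)) by (field; lra).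
apply (newton_int_le _ _ _ _ _ _ _ open_interval_0_infty) with
  (2 := gamma_int_Gamma (nu + p) ltac:(lra)) (3 := G2).
intros t Ht. simpl. rewrite gamma_integrand_shift by assumption.
replace (nu + 1 - 1) with nu by ring. rewrite (Rpower_minus_1 t nu) by assumption.
assert (H := Rpower_bernoulli (t / nu) p ltac:(now apply Rdiv_lt_0_compat) Hp).
apply Rmult_le_compat_l with (r := Rpower t (nu - 1) * exp (- t) * Rpower nu p) in H.
- eapply Rle_trans; [|eapply Rle_trans; [exact H|]]; right; field; lra.
- left. repeat apply Rmult_lt_0_compat; apply exp_pos.
Qed.

(** Here t^(nu+p-1) is written t^nu t^(-(1-p)) and bounded below by the tangent at t = nu. Together
    with [Gamma_shift_le] this gives Gamma(nu + p) ~ nu^p Gamma(nu). *)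
Lemma Gamma_shift_ge (nu p : R) : 0 < nu -> 0 <= p <= 1 ->
  Rpower nu p * Gamma nu * (1 - (1 - p) / nu) <= Gamma (nu + p).
Proof.
intros Hnu Hp.
assert (G0 := gamma_int_Gamma nu Hnu).
assert (G1 := gamma_int_S nu _ Hnu G0).
assert (G2 := gamma_int_S (nu + 1) _ ltac:(lra) G1).
assert (G3 := newton_int_lin _ _ _ _ _ (Rpower nu (p - 1) * (2 - p)) (Rpower nu (p - 1) * (- (1 - p) / nu)) _ _
  open_interval_0_infty G1 G2).
replace (Rpower nu p * Gamma nu * (1 - (1 - p) / nu)) with
  (Rpower nu (p - 1) * (2 - p) * (nu * Gamma nu) +
   Rpower nu (p - 1) * (- (1 - p) / nu) * ((nu + 1) * (nu * Gamma nu)))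
  by (rewrite (Rpower_minus_1 nu p) by assumption; field; lra).
apply (newton_int_le _ _ _ _ _ _ _ open_interval_0_infty) with
  (3 := gamma_int_Gamma (nu + p) ltac:(lra)) (2 := G3).
intros t Ht. simpl.
replace (nu + p) with (nu + 1 + (p - 1)) by ring.
replace (nu + 1 + (p - 1) - 1) with (nu + (p - 1)) by ring.
replace (nu + 1 + 1 - 1) with (nu + 1) by ring. replace (nu + 1 - 1) with nu by ring.
rewrite Rpower_plus_1, (Rpower_plus nu) by assumption.
assert (H := Rpower_opp_bernoulli (t / nu) (1 - p) ltac:(now apply Rdiv_lt_0_compat) ltac:(lra)).
apply Rmult_le_compat_l with (r := Rpower t nu * exp (- t) * Rpower nu (p - 1)) in H.
- replace (- (1 - p)) with (p - 1) in H by ring.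
  assert (E : Rpower t (p - 1) = Rpower nu (p - 1) * Rpower (t / nu) (p - 1)).
  { rewrite Rpower_mult_distr; [|lra|now apply Rdiv_lt_0_compat]. f_equal. field. lra. }
  rewrite E.
  eapply Rle_trans; [|eapply Rle_trans; [exact H|]]; right; field; lra.
- left. repeat apply Rmult_lt_0_compat; apply exp_pos.
Qed.

Lemma Rpower_amgm (x y p : R) : 0 < x -> 0 < y -> 0 <= p <= 1 ->
  Rpower x p * Rpower y (1 - p) <= p * x + (1 - p) * y.
Proof.
intros Hx Hy Hp.
assert (Hxy : 0 < x / y) by now apply Rdiv_lt_0_compat.
assert (E : Rpower x p = Rpower y p * Rpower (x / y) p).
{ rewrite Rpower_mult_distr by assumption. f_equal. field. lra. }
assert (E1 : Rpower y p * Rpower y (1 - p) = y).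
{ rewrite <- Rpower_plus. replace (p + (1 - p)) with 1 by ring. now apply Rpower_1. }
assert (H := Rpower_bernoulli (x / y) p Hxy Hp).
apply Rmult_le_compat_l with (r := y) in H; [|lra].
replace (Rpower x p * Rpower y (1 - p)) with (y * Rpower (x / y) p).
- eapply Rle_trans; [exact H|]. right. field. lra.
- rewrite E. rewrite <- E1 at 1. ring.
Qed.

(** The factor x^p (1 - x)^(1-p) is at most p x + (1 - p) (1 - x), and by symmetry x and 1 - x both
    have mean 1/2 for the weight of B(nu, nu). *)
Lemma beta_int_shift_le (nu p b0 b : R) : 0 < nu -> 0 < p < 1 ->
  beta_int nu nu b0 -> beta_int (nu + p) (nu + (1 - p)) b -> b <= b0 / 2.
Proof.
intros Hnu Hp B0 B.
assert (Bl := beta_int_Sl nu nu _ Hnu Hnu B0).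
assert (Br := beta_int_Sr nu nu _ Hnu Hnu B0).
replace (b0 / 2) with (p * (nu / (nu + nu) * b0) + (1 - p) * (nu / (nu + nu) * b0)) by (field; lra).
apply (newton_int_le _ _ _ _ _ _ _ open_interval_01) with
  (2 := B) (3 := newton_int_lin _ _ _ _ _ p (1 - p) _ _ open_interval_01 Bl Br).
intros x Hx. simpl.
replace (nu + 1 - 1) with nu by ring.
replace (nu + p - 1) with (nu - 1 + p) by ring.
replace (nu + (1 - p) - 1) with (nu - 1 + (1 - p)) by ring.
rewrite !Rpower_plus, (Rpower_minus_1 x nu), (Rpower_minus_1 (1 - x) nu) by lra.
assert (H := Rpower_amgm x (1 - x) p ltac:(lra) ltac:(lra) ltac:(lra)).
apply Rmult_le_compat_l with (r := Rpower x (nu - 1) * Rpower (1 - x) (nu - 1)) in H.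
- eapply Rle_trans; [|eapply Rle_trans; [exact H|]]; right; ring.
- left. apply Rmult_lt_0_compat; apply exp_pos.
Qed.

(* With L = (1-p) x + p (1-x) >= x^(1-p) (1-x)^p, use 1/L >= 4 - 4 L. *)
Lemma beta_int_shift_ge (nu p b0 b : R) : 0 < nu -> 0 < p < 1 ->
  beta_int nu nu b0 -> beta_int (nu + p) (nu + (1 - p)) b -> nu / (2 * nu + 1) * b0 <= b.
Proof.
intros Hnu Hp B0 B.
assert (B1 := beta_int_Sr (nu + 1) nu _ ltac:(lra) Hnu (beta_int_Sl nu nu _ Hnu Hnu B0)).
assert (Bl := beta_int_Sl (nu + 1) (nu + 1) _ ltac:(lra) ltac:(lra) B1).
(* Here 4 - 4 L = 4 (1 - p) - 4 (1 - 2 p) x. Integrated against x^nu (1 - x)^nu, for which x has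
   mean 1/2, it yields 2 B(nu+1, nu+1) = nu / (2 nu + 1) * b0. *)
replace (nu / (2 * nu + 1) * b0) with
  (4 * (1 - p) * (nu / (nu + 1 + nu) * (nu / (nu + nu) * b0)) +
   (- 4 * (1 - 2 * p)) * ((nu + 1) / (nu + 1 + (nu + 1)) * (nu / (nu + 1 + nu) * (nu / (nu + nu) * b0))))
  by (field; lra).
apply (newton_int_le _ _ _ _ _ _ _ open_interval_01) with
  (3 := B) (2 := newton_int_lin _ _ _ _ _ (4 * (1 - p)) (- 4 * (1 - 2 * p)) _ _ open_interval_01 B1 Bl).
intros x Hx. simpl.
replace (nu + 1 + 1 - 1) with (nu + 1) by ring.
replace (nu + 1 - 1) with nu by ring.
replace (nu + p - 1) with (nu + - (1 - p)) by ring.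
replace (nu + (1 - p) - 1) with (nu + - p) by ring.
rewrite Rpower_plus_1, !Rpower_plus, !Rpower_Ropp by lra.
set (A := Rpower x (1 - p)). set (A' := Rpower (1 - x) p).
assert (HA : 0 < A * A') by (apply Rmult_lt_0_compat; apply exp_pos).
assert (HAA : 0 < A /\ 0 < A') by (split; apply exp_pos).
assert (H := Rpower_amgm x (1 - x) (1 - p) ltac:(lra) ltac:(lra) ltac:(lra)).
replace (1 - (1 - p)) with p in H by ring. fold A A' in H.
assert (H1 : 4 - 4 * ((1 - p) * x + p * (1 - x)) <= / A * / A').
{ rewrite <- Rinv_mult. apply Rmult_le_reg_l with (A * A'); [assumption|].
  rewrite Rinv_r by lra. set (L := (1 - p) * x + p * (1 - x)) in *.
  destruct (Rle_lt_dec (4 - 4 * L) 0) as [HL|HL]; [nra|].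
  apply Rle_trans with (L * (4 - 4 * L)); [apply Rmult_le_compat_r; lra|].
  assert (0 <= (2 * L - 1) ^ 2) by apply pow2_ge_0. nra. }
apply Rmult_le_compat_l with (r := Rpower x nu * Rpower (1 - x) nu) in H1.
- eapply Rle_trans; [|eapply Rle_trans; [exact H1|]]; right; ring.
- left. apply Rmult_lt_0_compat; apply exp_pos.
Qed.

(** The Beta integral and the Gamma quotient obey the same two shift rules, so their ratio [K] is
    carried along unchanged. *)
Lemma beta_Gamma_shift (K p q : R) (i j : nat) : 0 < p -> 0 < q ->
  beta_int p q (K * (Gamma p * Gamma q / Gamma (p + q))) ->
  beta_int (p + INR i) (q + INR j)
    (K * (Gamma (p + INR i) * Gamma (q + INR j) / Gamma (p + INR i + (q + INR j)))).
Proof.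
intros Hp Hq H.
assert (Hl : beta_int (p + INR i) q (K * (Gamma (p + INR i) * Gamma q / Gamma (p + INR i + q)))).
{ induction i as [|i IH].
  - simpl. now rewrite Rplus_0_r.
  - rewrite S_INR. assert (H0 := pos_INR i). rewrite <- Rplus_assoc.
    rewrite (Gamma_S (p + INR i)) by lra.
    replace (p + INR i + 1 + q) with (p + INR i + q + 1) by ring.
    rewrite (Gamma_S (p + INR i + q)) by lra.
    assert (G := Gamma_pos (p + INR i + q) ltac:(lra)).
    assert (B := beta_int_Sl (p + INR i) q _ ltac:(lra) Hq IH).
    eapply newton_int_ext; [exact open_interval_01| | |exact B]; [reflexivity|].
    field. lra. }
assert (Hi := pos_INR i). clear H. induction j as [|j IH].
- simpl. now rewrite Rplus_0_r.
- rewrite S_INR. assert (H0 := pos_INR j). rewrite <- (Rplus_assoc q).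
  rewrite (Gamma_S (q + INR j)) by lra.
  rewrite <- (Rplus_assoc _ (q + INR j)).
  rewrite (Gamma_S (p + INR i + (q + INR j))) by lra.
  assert (G := Gamma_pos (p + INR i + (q + INR j)) ltac:(lra)).
  assert (B := beta_int_Sr (p + INR i) (q + INR j) _ ltac:(lra) ltac:(lra) IH).
  eapply newton_int_ext; [exact open_interval_01| | |exact B]; [reflexivity|].
  field. lra.
Qed.

Lemma beta_int_1_1 : beta_int 1 1 1.
Proof.
apply newton_int_ext with (f := fun _ => 1) (u := 1 - 0).
- exact open_interval_01.
- intros x Hx. replace (1 - 1) with 0 by ring. rewrite !Rpower_O by lra. ring.
- ring.
- apply newton_int_exact with (fun x => x) 0 1.
  + intros x _. apply continuous_const.
  + intros x _. apply (is_derive_id (K := R_AbsRing)).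
  + apply filter_le_within.
  + apply filter_le_within.
  + reflexivity.
Qed.

Lemma beta_Gamma_nat (m : nat) :
  beta_int (INR (S m)) (INR (S m)) (Gamma (INR (S m)) ^ 2 / Gamma (2 * INR (S m))).
Proof.
assert (G2 : Gamma (1 + 1) = 1) by (rewrite Gamma_S, Gamma_1; lra).
assert (B : beta_int 1 1 (1 * (Gamma 1 * Gamma 1 / Gamma (1 + 1)))).
{ rewrite G2, Gamma_1. eapply newton_int_ext; [exact open_interval_01| | |exact beta_int_1_1].
  - reflexivity.
  - field. }
assert (H := beta_Gamma_shift 1 1 1 m m Rlt_0_1 Rlt_0_1 B).
rewrite S_INR, Rplus_comm. replace (2 * (1 + INR m)) with (1 + INR m + (1 + INR m)) by ring.
eapply newton_int_ext; [exact open_interval_01| | |exact H]; [reflexivity|].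
unfold Rdiv. ring.
Qed.

(* Compare beta_int (n + p) (n + 1 - p) and Gamma (n + p) * Gamma (n + 1 - p) with
   their values at p = 0, as n tends to infinity. *)
Lemma beta_Gamma_reflection (p : R) : 0 < p < 1 -> beta_int p (1 - p) (Gamma p * Gamma (1 - p)).
Proof.
intros Hp.
destruct (beta_int_exists p (1 - p) ltac:(lra) ltac:(lra)) as [b Hb].
assert (Gp := Gamma_pos p ltac:(lra)). assert (Gq := Gamma_pos (1 - p) ltac:(lra)).
(* [K] is the unknown ratio of the integral to its expected value; the goal is K = 1. *)
set (K := b / (Gamma p * Gamma (1 - p))).
assert (HK0 : 0 < K).
{ apply Rdiv_lt_0_compat; [|now apply Rmult_lt_0_compat].
  apply (newton_int_pos _ _ _ _ _ open_interval_01) with (2 := Hb).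
  intros x Hx. apply Rmult_lt_0_compat; apply exp_pos. }
assert (HbK : beta_int p (1 - p) (K * (Gamma p * Gamma (1 - p) / Gamma (p + (1 - p))))).
{ replace (p + (1 - p)) with 1 by ring. rewrite Gamma_1.
  eapply newton_int_ext; [exact open_interval_01| | |exact Hb]; [reflexivity|].
  unfold K. field. lra. }
(* B(n+p, n+1-p) is compared with B(n,n), whose value is known from the integer case, and Gamma(n+p)
   Gamma(n+1-p) with n Gamma(n)^2. Both comparisons are exact up to factors 1 + O(1/n). *)
assert (Key : forall m, let n := INR (S m) in K * (1 - / n) <= 1 /\ 2 * n / (2 * n + 1) <= K).
{ intros m n. assert (Hn : 0 < n) by apply lt_0_INR, Nat.lt_0_succ.
  assert (B := beta_Gamma_shift K p (1 - p) (S m) (S m) ltac:(lra) ltac:(lra) HbK). fold n in B.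
  replace (p + n + (1 - p + n)) with (2 * n + 1) in B by ring.
  rewrite (Gamma_S (2 * n)) in B by lra.
  rewrite (Rplus_comm p n), (Rplus_comm (1 - p) n) in B.
  assert (B0 := beta_Gamma_nat m). fold n in B0.
  assert (Hle := beta_int_shift_le n p _ _ Hn Hp B0 B).
  assert (Hge := beta_int_shift_ge n p _ _ Hn Hp B0 B).
  assert (Hn1 : 1 <= n) by (unfold n; rewrite S_INR; generalize (pos_INR m); lra).
  assert (U1 := Gamma_shift_le n p Hn ltac:(lra)).
  assert (U2 := Gamma_shift_le n (1 - p) Hn ltac:(lra)).
  assert (L1 := Gamma_shift_ge n p Hn ltac:(lra)).
  assert (L2 := Gamma_shift_ge n (1 - p) Hn ltac:(lra)).
  assert (GG := Gamma_pos (2 * n) ltac:(lra)).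
  assert (Gn := Gamma_pos n Hn).
  assert (G1 := Gamma_pos (n + p) ltac:(lra)). assert (G2 := Gamma_pos (n + (1 - p)) ltac:(lra)).
  assert (E : Rpower n p * Rpower n (1 - p) = n).
  { rewrite <- Rpower_plus. replace (p + (1 - p)) with 1 by ring. now apply Rpower_1. }
  assert (P1 := Rpower_gt_0 n p). assert (P2 := Rpower_gt_0 n (1 - p)).
  assert (Hin : 0 < / n <= 1).
  { split; [now apply Rinv_0_lt_compat|]. rewrite <- Rinv_1. apply Rinv_le_contravar; lra. }
  assert (HU : Gamma (n + p) * Gamma (n + (1 - p)) <= n * Gamma n ^ 2).
  { replace (n * Gamma n ^ 2) with (Rpower n p * Gamma n * (Rpower n (1 - p) * Gamma n))
      by (transitivity (Rpower n p * Rpower n (1 - p) * Gamma n ^ 2); [ring|rewrite E; ring]).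
    apply Rmult_le_compat; lra. }
  assert (HL : n * Gamma n ^ 2 * (1 - / n) <= Gamma (n + p) * Gamma (n + (1 - p))).
  { assert (Q1 : 0 <= 1 - (1 - p) / n) by (unfold Rdiv; nra).
    assert (Q2 : 0 <= 1 - (1 - (1 - p)) / n) by (unfold Rdiv; nra).
    apply Rle_trans with (Rpower n p * Gamma n * (1 - (1 - p) / n) *
       (Rpower n (1 - p) * Gamma n * (1 - (1 - (1 - p)) / n))).
    - replace (Rpower n p * Gamma n * (1 - (1 - p) / n) *
       (Rpower n (1 - p) * Gamma n * (1 - (1 - (1 - p)) / n))) with
       (n * Gamma n ^ 2 * ((1 - (1 - p) / n) * (1 - p / n)))
       by (transitivity (Rpower n p * Rpower n (1 - p) * Gamma n ^ 2 * ((1 - (1 - p) / n) * (1 - p / n)));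
         [rewrite E; ring|field; lra]).
      apply Rmult_le_compat_l; [nra|]. unfold Rdiv.
      assert (0 <= p * (1 - p) * (/ n * / n)) by nra. nra.
    - apply Rmult_le_compat; try lra; repeat apply Rmult_le_pos; lra. }
  split.
  - apply Rmult_le_reg_l with (n * Gamma n ^ 2); [nra|].
    apply Rmult_le_compat_l with (r := 2 * n * Gamma (2 * n)) in Hle; [|nra].
    field_simplify in Hle; [|lra|lra]. nra.
  - apply Rmult_le_reg_r with (n * Gamma n ^ 2); [nra|].
    apply Rmult_le_compat_l with (r := 2 * n * Gamma (2 * n)) in Hge; [|nra].
    apply Rle_trans with (K * (Gamma (n + p) * Gamma (n + (1 - p)))); [|nra].
    eapply Rle_trans; [|eapply Rle_trans; [exact Hge|]]; right; field; lra. }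
assert (K1 : K = 1).
{ apply Rle_antisym.
  - apply Rnot_lt_le. intros H.
    destruct (nfloor_ex (K / (K - 1))) as [m [_ Hm]]; [left; apply Rdiv_lt_0_compat; lra|].
    destruct (Key m) as [H1 _]. rewrite S_INR in H1.
    assert (Hpos : 0 < INR m + 1) by (generalize (pos_INR m); lra).
    apply Rmult_lt_compat_r with (r := K - 1) in Hm; [|lra].
    replace (K / (K - 1) * (K - 1)) with K in Hm by (field; lra).
    apply Rmult_le_compat_r with (r := INR m + 1) in H1; [|lra].
    replace (K * (1 - / (INR m + 1)) * (INR m + 1)) with (K * (INR m + 1) - K) in H1 by (field; lra).
    nra.
  - apply Rnot_lt_le. intros H.
    destruct (nfloor_ex (/ (1 - K))) as [m [_ Hm]]; [left; apply Rinv_0_lt_compat; lra|].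
    destruct (Key m) as [_ H1]. rewrite S_INR in H1.
    assert (Hpos : 0 < INR m + 1) by (generalize (pos_INR m); lra).
    apply Rmult_lt_compat_r with (r := 1 - K) in Hm; [|lra].
    rewrite Rinv_l in Hm by lra.
    apply Rmult_le_compat_r with (r := 2 * (INR m + 1) + 1) in H1; [|lra].
    replace (2 * (INR m + 1) / (2 * (INR m + 1) + 1) * (2 * (INR m + 1) + 1)) with (2 * (INR m + 1))
      in H1 by (field; lra).
    nra. }
eapply newton_int_ext; [exact open_interval_01| | |exact Hb]; [reflexivity|].
unfold K in K1. apply Rmult_eq_reg_r with (/ (Gamma p * Gamma (1 - p))).
- unfold Rdiv in K1. rewrite K1. symmetry. apply Rinv_r. nra.
- apply Rinv_neq_0_compat. nra.
Qed.

Lemma beta_Gamma (p : R) (i j : nat) : 0 < p < 1 ->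
  beta_int (p + INR i) (1 - p + INR j)
    (Gamma (p + INR i) * Gamma (1 - p + INR j) / Gamma (p + INR i + (1 - p + INR j))).
Proof.
intros Hp.
assert (B : beta_int p (1 - p) (1 * (Gamma p * Gamma (1 - p) / Gamma (p + (1 - p))))).
{ replace (p + (1 - p)) with 1 by ring. rewrite Gamma_1.
  eapply newton_int_ext; [exact open_interval_01| | |exact (beta_Gamma_reflection p Hp)].
  - reflexivity.
  - field. }
assert (H := beta_Gamma_shift 1 p (1 - p) i j ltac:(lra) ltac:(lra) B).
eapply newton_int_ext; [exact open_interval_01| | |exact H]; [reflexivity|]. ring.
Qed.

(** Legendre's duplication formula at positive integers only, with Gamma(1/2) left unevaluated.
    Going from n to n + 1 merely exchanges the two half-arguments and raises one of them by 1, so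
    induction suffices. *)
Lemma Gamma_duplication (m : nat) :
  Gamma (INR (S m) / 2) * Gamma (INR (S m) / 2 + 1 / 2) * 2 ^ m = Gamma (1 / 2) * Gamma (INR (S m)).
Proof.
induction m as [|m IH].
- simpl. replace (1 / 2 + 1 / 2) with 1 by field. ring.
- rewrite (S_INR (S m)). set (n := INR (S m)) in *.
  assert (Hn : 0 < n) by apply lt_0_INR, Nat.lt_0_succ.
  replace ((n + 1) / 2 + 1 / 2) with (n / 2 + 1) by field.
  replace ((n + 1) / 2) with (n / 2 + 1 / 2) by field.
  rewrite (Gamma_S (n / 2)), (Gamma_S n) by lra.
  replace (Gamma (1 / 2) * (n * Gamma n)) with (n * (Gamma (1 / 2) * Gamma n)) by ring.
  rewrite <- IH. simpl. field.
Qed.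

(** * Hypergeometric functions with parameters p, p + 1/2 *)

Lemma poch_neq_0 (q : R) (k : nat) : (forall j, q + INR j <> 0) -> poch q k <> 0.
Proof.
intros Hq. induction k as [|k IH]; simpl; [lra|].
now apply Rmult_integral_contrapositive.
Qed.

Lemma poch_pos (q : R) (k : nat) : 0 < q -> 0 < poch q k.
Proof.
intros Hq. induction k as [|k IH]; [simpl; lra|].
apply Rmult_lt_0_compat; [exact IH|]. generalize (pos_INR k). lra.
Qed.

Lemma INR_fact_S (k : nat) : INR (fact (S k)) = INR (S k) * INR (fact k).
Proof. rewrite fact_simpl. apply mult_INR. Qed.

Definition binomial_coef (al : R) (j : nat) : R := poch al j / INR (fact j).

Lemma binomial_coef_S (al : R) (j : nat) :
  INR (S j) * binomial_coef al (S j) = (al + INR j) * binomial_coef al j.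
Proof.
unfold binomial_coef. rewrite INR_fact_S. simpl poch.
assert (H := INR_fact_neq_0 j). assert (H1 : INR (S j) <> 0) by now apply not_0_INR.
field. now split.
Qed.

Lemma is_lim_seq_ratio (al : R) : is_lim_seq (fun n => (al + INR n) / INR (S n)) 1.
Proof.
apply is_lim_seq_ext with (fun n => 1 + (al - 1) * / INR (S n)).
- intros n. rewrite S_INR. generalize (pos_INR n). intros. field. lra.
- replace (Finite 1) with (Rbar_plus 1 (Rbar_mult (al - 1) 0)) by (simpl; f_equal; ring).
  apply is_lim_seq_plus'; [apply is_lim_seq_const|].
  apply (is_lim_seq_scal_l _ (al - 1) 0).
  apply (is_lim_seq_incr_1 (fun n => / INR n)).
  replace (Finite 0) with (Rbar_inv p_infty) by reflexivity.
  apply is_lim_seq_inv; [apply is_lim_seq_INR|discriminate].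
Qed.

(** The hypothesis excludes terminating series, to which the ratio test does not apply; it is the
    origin of the nonvanishing conditions on a - b further on. *)
Lemma binomial_coef_CV_radius (al : R) :
  (forall j, al + INR j <> 0) -> CV_radius (binomial_coef al) = 1.
Proof.
intros Hal.
replace (Finite 1) with (Finite (/ 1)) by (f_equal; apply Rinv_1).
assert (Hn : forall n, binomial_coef al n <> 0).
{ intros n. unfold binomial_coef, Rdiv. apply Rmult_integral_contrapositive. split.
  - now apply poch_neq_0.
  - apply Rinv_neq_0_compat, INR_fact_neq_0. }
apply CV_radius_finite_DAlembert; [exact Hn|lra|].
apply is_lim_seq_ext with (fun n => Rabs ((al + INR n) / INR (S n))).
- intros n. f_equal. assert (H := binomial_coef_S al n).
  assert (H1 : INR (S n) <> 0) by now apply not_0_INR.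
  apply Rmult_eq_reg_r with (INR (S n) * binomial_coef al n); [|now apply Rmult_integral_contrapositive].
  specialize (Hn n).
  transitivity ((al + INR n) * binomial_coef al n); [field; assumption|].
  rewrite <- H. field. assumption.
- replace (Finite 1) with (Rbar_abs 1) by (simpl; now rewrite Rabs_R1).
  apply is_lim_seq_abs, is_lim_seq_ratio.
Qed.

(* (1 - t) P' = al P for the series P, so P(t) (1 - t)^al is constant. *)
Lemma binomial_series (al s : R) : (forall j, al + INR j <> 0) -> Rabs s < 1 ->
  PSeries (binomial_coef al) s = Rpower (1 - s) (- al).
Proof.
intros Hal Hs.
set (P := PSeries (binomial_coef al)).
set (P' := PSeries (PS_derive (binomial_coef al))).
assert (Hcv := binomial_coef_CV_radius al Hal).
assert (ODE : forall t, Rabs t < 1 -> (1 - t) * P' t = al * P t).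
{ intros t Ht.
  assert (E : P' t = al * P t + t * P' t); [|lra].
  unfold P', P. rewrite <- PSeries_incr_1, <- PSeries_scal, <- PSeries_plus.
  - apply PSeries_ext. intros n.
    change (INR (S n) * binomial_coef al (S n) = al * binomial_coef al n +
      PS_incr_1 (PS_derive (binomial_coef al)) n).
    rewrite binomial_coef_S. destruct n as [|n].
    + change (INR 0) with 0. change (PS_incr_1 (PS_derive (binomial_coef al)) 0) with 0. ring.
    + change (PS_incr_1 (PS_derive (binomial_coef al)) (S n)) with
        (INR (S n) * binomial_coef al (S n)). ring.
  - apply ex_pseries_scal; [intros; apply Rmult_comm|].
    apply CV_radius_inside. rewrite Hcv. exact Ht.
  - apply ex_pseries_incr_1, CV_radius_inside. rewrite CV_radius_derive, Hcv. exact Ht. }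
assert (dh : forall t, Rabs t < 1 -> is_derive (fun t => P t * Rpower (1 - t) al) t 0).
{ intros t Ht. evar_last.
  - apply (is_derive_mult (K := R_AbsRing) P (fun t => Rpower (1 - t) al)).
    + apply is_derive_PSeries. rewrite Hcv. exact Ht.
    + apply is_derive_Rpower_compl. apply Rabs_def2 in Ht. lra.
    + intros; apply Rmult_comm.
  - fold P'. unfold plus, mult; simpl. apply Rabs_def2 in Ht as Ht'.
    rewrite (Rpower_minus_1 (1 - t) al) by lra. specialize (ODE t Ht).
    transitivity (((1 - t) * P' t - al * P t) * Rpower (1 - t) (al - 1)); [ring|].
    rewrite ODE. ring. }
assert (P0 : P 0 * Rpower (1 - 0) al = 1).
{ unfold P. rewrite PSeries_0. unfold binomial_coef. simpl.
  rewrite Rminus_0_r. unfold Rpower. rewrite ln_1, Rmult_0_r, exp_0. field. }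
assert (Ps : P s * Rpower (1 - s) al = 1).
{ destruct (Rle_lt_dec 0 s) as [H|H].
  - destruct (derive_increment (fun t => P t * Rpower (1 - t) al) (fun _ => 0) 0 s) as [c [_ E]];
      [lra| |lra].
    intros x Hx. apply dh. apply Rabs_def2 in Hs. apply Rabs_def1; lra.
  - destruct (derive_increment (fun t => P t * Rpower (1 - t) al) (fun _ => 0) s 0) as [c [_ E]];
      [lra| |lra].
    intros x Hx. apply dh. apply Rabs_def2 in Hs. apply Rabs_def1; lra. }
rewrite Rpower_Ropp. assert (H := Rpower_gt_0 (1 - s) al).
apply Rmult_eq_reg_r with (Rpower (1 - s) al); [|lra]. rewrite Ps. field. lra.
Qed.

(** For u strictly between |s| and the radius, the terms a_n u^n are bounded; hence so are those of
    the subsequence at u^2, whose radius is therefore at least u^2 > s^2. *)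
Lemma ex_pseries_subsequence (a : nat -> R) (r : nat) (s : R) :
  Rbar_lt (Rabs s) (CV_radius a) ->
  ex_pseries (fun n => a (2 * n + r)%nat) (s ^ 2).
Proof.
intros Hs.
assert (exists u, Rabs s < u /\ Rbar_lt u (CV_radius a)) as [u [Hsu Hu]].
{ destruct (CV_radius a) as [R0| |]; simpl in *.
  - exists ((Rabs s + R0) / 2). lra.
  - exists (Rabs s + 1). split; [lra|exact I].
  - contradiction. }
assert (Hs0 := Rabs_pos s).
destruct (CV_radius_inside a u) as [l Hl].
{ rewrite Rabs_pos_eq by lra. exact Hu. }
assert (Hbd : exists M, forall n, Rabs (a n * u ^ n) <= M).
{ assert (L : is_lim_seq (fun n => a n * u ^ n) 0).
  { apply ex_series_lim_0. exists l. apply is_pseries_R in Hl. exact Hl. }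
  destruct (filterlim_bounded (V := R_NormedModule) (fun n => a n * u ^ n)) as [M HM].
  - exists 0. exact L.
  - now exists M. }
destruct Hbd as [M HM].
apply CV_radius_inside.
apply Rbar_lt_le_trans with (Finite (u ^ 2)).
- rewrite Rabs_pos_eq by apply pow2_ge_0. rewrite <- (pow2_abs s). simpl. nra.
- apply (proj1 (CV_radius_bounded _)). exists (M / u ^ r). intros n.
  assert (Hur : 0 < u ^ r) by (apply pow_lt; lra).
  specialize (HM (2 * n + r)%nat). rewrite pow_add, pow_mult, <- Rmult_assoc, Rabs_mult in HM.
  rewrite (Rabs_pos_eq (u ^ r)) in HM by lra.
  apply Rmult_le_reg_r with (u ^ r); [assumption|].
  replace (M / u ^ r * u ^ r) with M by (field; lra). exact HM.
Qed.

(** Both (2p)_(2k) = 4^k (p)_k (p+1/2)_k and (2k)! = 4^k (1/2)_k k! split a product over even and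
    odd factors; the powers of 4 cancel. *)
Lemma poch_double (p : R) (k : nat) :
  poch (2 * p) (2 * k) * (poch (1 / 2) k * INR (fact k)) =
  poch p k * poch (p + 1 / 2) k * INR (fact (2 * k)).
Proof.
induction k as [|k IH]; [simpl; ring|].
replace (2 * S k)%nat with (S (S (2 * k))) by lia.
rewrite !INR_fact_S.
change (poch (2 * p) (S (S (2 * k)))) with
  (poch (2 * p) (2 * k) * (2 * p + INR (2 * k)) * (2 * p + INR (S (2 * k)))).
change (poch (1 / 2) (S k)) with (poch (1 / 2) k * (1 / 2 + INR k)).
change (poch p (S k)) with (poch p k * (p + INR k)).
change (poch (p + 1 / 2) (S k)) with (poch (p + 1 / 2) k * (p + 1 / 2 + INR k)).
rewrite !S_INR, mult_INR. change (INR 2) with 2.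
transitivity ((poch (2 * p) (2 * k) * (poch (1 / 2) k * INR (fact k))) *
  ((2 * p + 2 * INR k) * (2 * p + (2 * INR k + 1)) * (1 / 2 + INR k) * (INR k + 1))); [ring|].
rewrite IH. field.
Qed.

Lemma poch_double_S (p : R) (k : nat) :
  poch (2 * p - 1) (2 * k + 1) * (poch (3 / 2) k * INR (fact k)) =
  (2 * p - 1) * (poch p k * poch (p + 1 / 2) k) * INR (fact (2 * k + 1)).
Proof.
induction k as [|k IH]; [simpl; ring|].
replace (2 * S k + 1)%nat with (S (S (2 * k + 1))) by lia.
rewrite !INR_fact_S.
change (poch (2 * p - 1) (S (S (2 * k + 1)))) with
  (poch (2 * p - 1) (2 * k + 1) * (2 * p - 1 + INR (2 * k + 1)) * (2 * p - 1 + INR (S (2 * k + 1)))).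
change (poch (3 / 2) (S k)) with (poch (3 / 2) k * (3 / 2 + INR k)).
change (poch p (S k)) with (poch p k * (p + INR k)).
change (poch (p + 1 / 2) (S k)) with (poch (p + 1 / 2) k * (p + 1 / 2 + INR k)).
rewrite !S_INR, plus_INR, mult_INR. change (INR 2) with 2. change (INR 1) with 1.
transitivity ((poch (2 * p - 1) (2 * k + 1) * (poch (3 / 2) k * INR (fact k))) *
  ((2 * p - 1 + (2 * INR k + 1)) * (2 * p - 1 + (2 * INR k + 1 + 1)) * (3 / 2 + INR k) * (INR k + 1))); [ring|].
rewrite IH. field.
Qed.

(* F21 at parameters (p, p + 1/2) is the even (resp. odd) part of a binomial series. *)
Lemma F21_1_2 (p s : R) : (forall j, 2 * p + INR j <> 0) -> 0 < s < 1 ->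
  F21 p (p + 1 / 2) (1 / 2) (s ^ 2) = (Rpower (1 - s) (- (2 * p)) + Rpower (1 + s) (- (2 * p))) / 2.
Proof.
intros Hp Hs.
set (a := binomial_coef (2 * p)).
assert (Hs1 : Rabs s < 1) by (apply Rabs_def1; lra).
assert (Hs2 : Rabs (- s) < 1) by now rewrite Rabs_Ropp.
assert (Hcv : Rbar_lt (Rabs s) (CV_radius a)) by (unfold a; rewrite binomial_coef_CV_radius; assumption).
assert (E : F21 p (p + 1 / 2) (1 / 2) (s ^ 2) = PSeries (fun n => a (2 * n)%nat) (s ^ 2)).
{ apply Series_ext. intros n. f_equal. unfold a, binomial_coef.
  assert (H := poch_double p n). assert (H1 := poch_pos (1 / 2) n ltac:(lra)).
  assert (H2 := INR_fact_neq_0 n). assert (H3 := INR_fact_neq_0 (2 * n)).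
  apply Rmult_eq_reg_r with (poch (1 / 2) n * INR (fact n) * INR (fact (2 * n))).
  - field_simplify; [|assumption|lra]. rewrite <- H. ring.
  - repeat apply Rmult_integral_contrapositive_currified; lra. }
assert (Ho := ex_pseries_subsequence a 1 s Hcv).
assert (He : ex_pseries (fun n => a (2 * n)%nat) (s ^ 2)).
{ generalize (ex_pseries_subsequence a 0 s Hcv). apply ex_series_ext.
  intros n. now rewrite Nat.add_0_r. }
assert (E1 := PSeries_odd_even a s He Ho).
assert (E2 := PSeries_odd_even a (- s)).
replace ((- s) ^ 2) with (s ^ 2) in E2 by ring. specialize (E2 He Ho).
unfold a in E1 at 1. rewrite binomial_series in E1 by assumption.
unfold a in E2 at 1. rewrite binomial_series in E2 by assumption.
replace (1 - - s) with (1 + s) in E2 by ring.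
rewrite E, E1, E2. field.
Qed.

Lemma F21_3_2 (p s : R) : (forall j, 2 * p - 1 + INR j <> 0) -> 0 < s < 1 ->
  F21 p (p + 1 / 2) (3 / 2) (s ^ 2) =
  (Rpower (1 - s) (- (2 * p - 1)) - Rpower (1 + s) (- (2 * p - 1))) / (2 * s * (2 * p - 1)).
Proof.
intros Hp Hs.
set (a := binomial_coef (2 * p - 1)).
assert (Hp0 : 2 * p - 1 <> 0) by (specialize (Hp 0%nat); simpl in Hp; lra).
assert (Hs1 : Rabs s < 1) by (apply Rabs_def1; lra).
assert (Hs2 : Rabs (- s) < 1) by now rewrite Rabs_Ropp.
assert (Hcv : Rbar_lt (Rabs s) (CV_radius a)) by (unfold a; rewrite binomial_coef_CV_radius; assumption).
assert (E : (2 * p - 1) * F21 p (p + 1 / 2) (3 / 2) (s ^ 2) = PSeries (fun n => a (2 * n + 1)%nat) (s ^ 2)).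
{ unfold F21. rewrite <- Series_scal_l. apply Series_ext. intros n. rewrite <- Rmult_assoc. f_equal.
  unfold a, binomial_coef.
  assert (H := poch_double_S p n). assert (H1 := poch_pos (3 / 2) n ltac:(lra)).
  assert (H2 := INR_fact_neq_0 n). assert (H3 := INR_fact_neq_0 (2 * n + 1)).
  apply Rmult_eq_reg_r with (poch (3 / 2) n * INR (fact n) * INR (fact (2 * n + 1))).
  - transitivity ((2 * p - 1) * (poch p n * poch (p + 1 / 2) n) * INR (fact (2 * n + 1))).
    + field. lra.
    + rewrite <- H. field. assumption.
  - repeat apply Rmult_integral_contrapositive_currified; lra. }
assert (Ho := ex_pseries_subsequence a 1 s Hcv).
assert (He : ex_pseries (fun n => a (2 * n)%nat) (s ^ 2)).
{ generalize (ex_pseries_subsequence a 0 s Hcv). apply ex_series_ext.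
  intros n. now rewrite Nat.add_0_r. }
assert (E1 := PSeries_odd_even a s He Ho).
assert (E2 := PSeries_odd_even a (- s)).
replace ((- s) ^ 2) with (s ^ 2) in E2 by ring. specialize (E2 He Ho).
unfold a in E1 at 1. rewrite binomial_series in E1 by assumption.
unfold a in E2 at 1. rewrite binomial_series in E2 by assumption.
replace (1 - - s) with (1 + s) in E2 by ring.
rewrite <- E in E1, E2.
rewrite E1, E2. field. split; [assumption|lra].
Qed.

Lemma F21_sym (p q r z : R) : F21 p q r z = F21 q p r z.
Proof. apply Series_ext. intros n. now rewrite (Rmult_comm (poch p n)). Qed.

(** * Moments of the weights *)

Lemma sqrt_compl_bounds (x : R) : 0 < x < 1 -> 0 < sqrt (1 - x) < 1.
Proof.
intros Hx. split; [apply sqrt_lt_R0; lra|].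
rewrite <- sqrt_1 at 2. apply sqrt_lt_1; lra.
Qed.

Lemma filterlim_within_at_right (f : R -> R) (F : (R -> Prop) -> Prop) {FF : Filter F} (l : R) :
  filterlim f F (locally l) -> F (fun x => l < f x) -> filterlim f F (at_right l).
Proof.
intros Hf Hl P HP. unfold filtermap, at_right, within in *.
assert (H : F (fun x => l < f x -> P (f x))) by exact (Hf _ HP).
generalize (filter_and _ _ H Hl). apply filter_imp. intros x [H1 H2]. auto.
Qed.

(* The substitution x = 4 y (1 - y), with both inverse branches y = (1 -+ sqrt (1 - x)) / 2. *)
Lemma newton_int_fold (f : R -> R) (v : R) :
  newton_int (fun x => 0 < x < 1) (at_right 0) (at_left 1) f v ->
  newton_int (fun x => 0 < x < 1) (at_right 0) (at_left 1)
    (fun x => (f ((1 - sqrt (1 - x)) / 2) + f (1 - (1 - sqrt (1 - x)) / 2)) / (4 * sqrt (1 - x))) v.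
Proof.
intros [Cf [F [la [lb [dF [Fla [Flb ->]]]]]]].
set (y := fun x => (1 - sqrt (1 - x)) / 2).
assert (Hy : forall x, 0 < x < 1 -> 0 < y x < 1 / 2).
{ intros x Hx. assert (H := sqrt_compl_bounds x Hx). unfold y. lra. }
assert (dy : forall x, 0 < x < 1 -> is_derive y x (/ (4 * sqrt (1 - x)))).
{ intros x Hx. assert (H := sqrt_compl_bounds x Hx). unfold y, Rminus in *. auto_derive; [lra|]. field. lra. }
assert (Cy : forall x, 0 < x < 1 -> continuous y x).
{ intros x Hx. apply (ex_derive_continuous (V := R_NormedModule)). eexists. now apply dy. }
assert (Csq : forall x, continuous (fun x => sqrt (1 - x)) x).
{ intros x. apply (continuous_comp (fun x => 1 - x) sqrt).
  - apply (ex_derive_continuous (V := R_NormedModule)). auto_derive. exact I.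
  - apply continuous_sqrt. }
assert (Cy' : forall x, continuous y x).
{ intros x. unfold y. apply (continuous_comp (fun x => sqrt (1 - x)) (fun s => (1 - s) / 2)); [apply Csq|].
  apply (ex_derive_continuous (V := R_NormedModule)). auto_derive. exact I. }
assert (in01_0 : at_right 0 (fun x => 0 < x < 1)).
{ unfold at_right, within. apply (filter_imp (fun x => x < 1)); [intros; lra|apply open_lt; lra]. }
assert (y0 : filterlim y (at_right 0) (at_right 0)).
{ apply (filterlim_within_at_right y (at_right 0)).
  - replace 0 with (y 0) at 2 by (unfold y; rewrite Rminus_0_r, sqrt_1; field).
    apply (filterlim_filter_le_1 (F := locally 0)); [apply filter_le_within|]. apply Cy'.
  - revert in01_0. apply filter_imp. intros x Hx. now apply Hy. }
assert (y1 : filterlim y (at_left 1) (locally (1 / 2))).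
{ replace (1 / 2) with (y 1) by (unfold y; rewrite Rminus_diag, sqrt_0; field).
  apply (filterlim_filter_le_1 (F := locally 1)); [apply filter_le_within|]. apply Cy'. }
split.
- intros x Hx. assert (H := sqrt_compl_bounds x Hx). specialize (Hy x Hx).
  apply (continuous_mult (K := R_AbsRing) (fun x => f (y x) + f (1 - y x)) (fun x => / (4 * sqrt (1 - x)))).
  + apply (continuous_plus (fun x => f (y x)) (fun x => f (1 - y x))).
    * apply (continuous_comp y f); [now apply Cy|apply Cf; lra].
    * apply (continuous_comp y (fun t => f (1 - t))); [now apply Cy|].
      apply (continuous_comp (fun t => 1 - t) f); [|apply Cf; lra].
      apply (ex_derive_continuous (V := R_NormedModule)). auto_derive. exact I.
  + apply (ex_derive_continuous (V := R_NormedModule)). auto_derive.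
    change (1 + - x) with (1 - x). repeat split; lra.
(* The primitive F(y) - F(1 - y) runs from la - lb at x = 0 to 0 at x = 1, where the two branches
   meet at y = 1/2. *)
- exists (fun x => 1 * F (y x) + (-1) * F (1 - y x)), (1 * la + (-1) * lb),
    (1 * F (1 / 2) + (-1) * F (1 - 1 / 2)).
  split; [|split; [|split]].
  + intros x Hx. assert (H := sqrt_compl_bounds x Hx). specialize (Hy x Hx).
    evar_last.
    * apply (is_derive_plus (fun x => 1 * F (y x)) (fun x => (-1) * F (1 - y x))).
      -- apply is_derive_scal. apply (is_derive_comp F y); [apply dF; lra|now apply dy].
      -- apply is_derive_scal. apply (is_derive_comp F (fun x => 1 - y x)); [apply dF; lra|].
         apply (is_derive_minus (fun _ => 1) y); [apply is_derive_const|now apply dy].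
    * unfold plus, minus, opp, zero, scal; simpl; unfold mult; simpl. fold (y x). change (plus 0 (- / (4 * sqrt (1 - x)))) with (0 + - / (4 * sqrt (1 - x))). field. lra.
  + apply filterlim_lin.
    * apply (filterlim_comp _ _ _ y F _ (at_right 0)); assumption.
    * apply (filterlim_comp _ _ _ y (fun t => F (1 - t)) _ (at_right 0)); [assumption|].
      apply (filterlim_comp _ _ _ (fun t => 1 - t) F _ (at_left 1)); [apply compl_lim_right_0|assumption].
  + assert (CF : forall t, 0 < t < 1 -> continuous F t).
    { intros t Ht. apply (ex_derive_continuous (V := R_NormedModule)). eexists. now apply dF. }
    apply filterlim_lin.
    * apply (filterlim_comp _ _ _ y F _ (locally (1 / 2))); [assumption|]. apply CF. lra.
    * apply (filterlim_comp _ _ _ y (fun t => F (1 - t)) _ (locally (1 / 2))); [assumption|].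
      apply (continuous_comp (fun t => 1 - t) F); [|apply CF; lra].
      apply (ex_derive_continuous (V := R_NormedModule)). auto_derive. exact I.
  + replace (1 - 1 / 2) with (1 / 2) by field. ring.
Qed.

Lemma Rpower_half (x y : R) : 0 < x -> Rpower (x / 2) y = Rpower x y * Rpower 2 (- y).
Proof.
intros Hx. apply Rmult_eq_reg_r with (Rpower 2 y); [|apply Rgt_not_eq, exp_pos].
rewrite Rpower_mult_distr by lra. rewrite Rmult_assoc, <- Rpower_plus.
replace (- y + y) with 0 by ring. rewrite Rpower_O by lra.
replace (x / 2 * 2) with x by field. ring.
Qed.

Lemma pow_sqrt_compl (x : R) : x < 1 -> sqrt (1 - x) ^ 2 = 1 - x.
Proof. intros Hx. apply pow2_sqrt. lra. Qed.

Lemma Rpower_sqrt_factor (x r : R) (k : nat) : 0 < x < 1 ->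
  x ^ k * Rpower x (r - 1) =
  Rpower (1 - sqrt (1 - x)) (r + INR k - 1) * Rpower (1 + sqrt (1 - x)) (r + INR k - 1).
Proof.
intros Hx. assert (H := sqrt_compl_bounds x Hx).
rewrite Rpower_mult_distr by lra.
replace ((1 - sqrt (1 - x)) * (1 + sqrt (1 - x))) with x
  by (transitivity (1 - sqrt (1 - x) ^ 2); [rewrite pow_sqrt_compl by lra|]; ring).
rewrite <- Rpower_pow, <- Rpower_plus by lra. f_equal. ring.
Qed.

(* Up to a constant the weights are y^(a-1) (1-y)^(b-1) +- y^(b-1) (1-y)^(a-1), x = 4 y (1 - y). *)
Lemma weight_int_1_2 (a b B : R) (k : nat) : 0 < a -> 0 < b -> (forall j, a - b + INR j <> 0) ->
  beta_int (a + INR k) (b + INR k) B ->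
  newton_int (fun x => 0 < x < 1) (at_right 0) (at_left 1)
    (fun x => x ^ k * F21 ((a - b) / 2) ((a - b) / 2 + 1 / 2) (1 / 2) (1 - x) *
              Rpower x (a - 1) * Rpower (1 - x) (1 / 2 - 1))
    (Rpower 2 (a + b + 2 * INR k - 1) * B).
Proof.
intros Ha Hb Hab HB.
apply newton_int_ext with (4 := newton_int_scal _ _ _ _ (Rpower 2 (a + b + 2 * INR k - 1)) _
  open_interval_01 (newton_int_fold _ _ HB)); [exact open_interval_01| |reflexivity].
intros x Hx. assert (H := sqrt_compl_bounds x Hx).
rewrite (Rmult_comm (x ^ k)), 2 Rmult_assoc, <- (Rmult_assoc (x ^ k)), Rpower_sqrt_factor by assumption.
assert (E : Rpower (1 - x) (1 / 2 - 1) = / sqrt (1 - x)).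
{ replace (1 / 2 - 1) with (- / 2) by field. rewrite Rpower_Ropp, Rpower_sqrt by lra. reflexivity. }
assert (EF : forall j, 2 * ((a - b) / 2) + INR j <> 0).
{ intros j. replace (2 * ((a - b) / 2)) with (a - b) by field. apply Hab. }
apply (F21_1_2 _ (sqrt (1 - x))) in EF; [|exact H].
rewrite pow_sqrt_compl in EF by lra. rewrite E, EF.
set (s := sqrt (1 - x)) in *.
replace (1 - (1 - s) / 2) with ((1 + s) / 2) by field.
replace (1 - (1 + s) / 2) with ((1 - s) / 2) by field.
rewrite !Rpower_half by lra.
(* Since x = (1 - s) (1 + s), the second part of the split exponent cancels one factor of x^(a+k-1),
   leaving (1 -+ s)^(b+k-1) (1 +- s)^(a+k-1). *)
replace (- (2 * ((a - b) / 2))) with (b + INR k - 1 + - (a + INR k - 1)) by field.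
rewrite !(Rpower_plus (b + INR k - 1)), !Rpower_Ropp.
replace (a + b + 2 * INR k - 1) with (a + INR k - 1 + (b + INR k - 1) + 1) by ring.
rewrite Rpower_plus_1, Rpower_plus by lra.
assert (Q : forall z r, Rpower z r <> 0) by (intros; apply Rgt_not_eq, exp_pos).
field. repeat split; try apply Q; lra.
Qed.

Lemma weight_int_3_2 (a b B : R) (k : nat) : 0 < a -> 0 < b -> (forall j, a - b + INR j <> 0) ->
  beta_int (a + INR k) (b + INR k) B ->
  newton_int (fun x => 0 < x < 1) (at_right 0) (at_left 1)
    (fun x => x ^ k * F21 ((a - b + 1) / 2) ((a - b + 1) / 2 + 1 / 2) (3 / 2) (1 - x) *
              Rpower x (a - 1) * Rpower (1 - x) (3 / 2 - 1))
    (Rpower 2 (a + b + 2 * INR k - 1) * B / (a + b + 2 * INR k)).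
Proof.
intros Ha Hb Hab HB. assert (Hk := pos_INR k).
assert (Hab0 : b - a <> 0) by (specialize (Hab 0%nat); simpl in Hab; lra).
assert (Br := beta_int_Sr (a + INR k) (b + INR k) B ltac:(lra) ltac:(lra) HB).
assert (Bl := beta_int_Sl (a + INR k) (b + INR k) B ltac:(lra) ltac:(lra) HB).
(* The difference of the integrands of [Br] and [Bl] carries the factor 1 - 2 y, that is +-s on the
   two branches. It produces the minus sign of the odd part and cancels the s in the Jacobian; the
   integral then brings b - a, divided out here. *)
set (C := Rpower 2 (a + b + 2 * INR k - 1) / (b - a)).
apply newton_int_ext with (4 := newton_int_fold _ _
  (newton_int_lin _ _ _ _ _ C (- C) _ _ open_interval_01 Br Bl));
  [exact open_interval_01| |unfold C; field; lra].
intros x Hx. assert (H := sqrt_compl_bounds x Hx).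
rewrite (Rmult_comm (x ^ k)), 2 Rmult_assoc, <- (Rmult_assoc (x ^ k)), Rpower_sqrt_factor by assumption.
assert (E : Rpower (1 - x) (3 / 2 - 1) = sqrt (1 - x)).
{ replace (3 / 2 - 1) with (/ 2) by field. rewrite Rpower_sqrt by lra. reflexivity. }
assert (EF : forall j, 2 * ((a - b + 1) / 2) - 1 + INR j <> 0).
{ intros j. replace (2 * ((a - b + 1) / 2) - 1) with (a - b) by field. apply Hab. }
apply (F21_3_2 _ (sqrt (1 - x))) in EF; [|exact H].
rewrite pow_sqrt_compl in EF by lra. rewrite E, EF.
set (s := sqrt (1 - x)) in *.
replace (1 - (1 - s) / 2) with ((1 + s) / 2) by field.
replace (1 - (1 + s) / 2) with ((1 - s) / 2) by field.
replace (a + INR k + 1 - 1) with (a + INR k) by ring.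
replace (b + INR k + 1 - 1) with (b + INR k) by ring.
rewrite (Rpower_minus_1 _ (a + INR k)), (Rpower_minus_1 _ (b + INR k)) by lra.
rewrite (Rpower_minus_1 ((1 + s) / 2) (a + INR k)), (Rpower_minus_1 ((1 - s) / 2) (b + INR k)) by lra.
rewrite !Rpower_half by lra.
replace (- (2 * ((a - b + 1) / 2) - 1)) with (b + INR k - 1 + - (a + INR k - 1)) by field.
rewrite !(Rpower_plus (b + INR k - 1)), !Rpower_Ropp. unfold C.
replace (a + b + 2 * INR k - 1) with (a + INR k - 1 + (b + INR k - 1) + 1) by ring.
rewrite Rpower_plus_1, Rpower_plus by lra.
assert (Q : forall z r, Rpower z r <> 0) by (intros; apply Rgt_not_eq, exp_pos).
field. repeat split; try apply Q; lra.
Qed.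

Lemma Gamma_poch (q : R) (k : nat) : 0 < q -> Gamma (q + INR k) = poch q k * Gamma q.
Proof.
intros Hq. induction k as [|k IH]; simpl poch; [simpl; rewrite Rplus_0_r; ring|].
rewrite S_INR, <- Rplus_assoc, Gamma_S, IH by (generalize (pos_INR k); lra). ring.
Qed.

(** The form of [a] and [b] makes a + b an integer, so the Beta value is known and the duplication
    formula applies to Gamma(c+k) Gamma(d+k), as d = c + 1/2. The two cases for 2 c are delta = 1/2
    and delta = 3/2. *)
Lemma w1_moment (p : R) (i j k : nat) (a b c d : R) : 0 < p < 1 ->
  a = p + INR i -> b = 1 - p + INR j -> d = c + 1 / 2 ->
  2 * c = a + b \/ 2 * c = a + b + 1 -> (forall l, a - b + INR l <> 0) ->
  mu_int_is a b c d (fun x => x ^ k * w1 a b c d x)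
    (poch a k * poch b k / (poch c k * poch d k)).
Proof.
intros Hp Ea Eb Ed Hc Hab.
assert (Hi := pos_INR i). assert (Hj := pos_INR j). assert (Hk := pos_INR k).
assert (Ha : 0 < a) by lra. assert (Hb : 0 < b) by lra.
assert (Hc0 : 0 < c) by (destruct Hc; lra). assert (Hd0 : 0 < d) by lra.
assert (HB : beta_int (a + INR k) (b + INR k)
   (poch a k * Gamma a * (poch b k * Gamma b) / Gamma (a + b + 2 * INR k))).
{ rewrite <- !Gamma_poch by assumption.
  generalize (beta_Gamma p (i + k) (j + k) Hp). rewrite !plus_INR.
  replace (p + (INR i + INR k)) with (a + INR k) by lra.
  replace (1 - p + (INR j + INR k)) with (b + INR k) by lra.
  replace (a + INR k + (b + INR k)) with (a + b + 2 * INR k) by ring. auto. }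
assert (Ga := Gamma_pos a Ha). assert (Gb := Gamma_pos b Hb).
assert (Gc := Gamma_pos c Hc0). assert (Gd := Gamma_pos d Hd0).
assert (Gab := Gamma_pos (a + b + 2 * INR k) ltac:(lra)).
assert (Gh := Gamma_pos (1 / 2) ltac:(lra)).
assert (Pc := poch_pos c k Hc0). assert (Pd := poch_pos d k Hd0).
assert (Gck := Gamma_poch c k Hc0). assert (Gdk := Gamma_poch d k Hd0).
set (m := (i + j + 2 * k)%nat).
assert (Em : INR (S m) = a + b + 2 * INR k).
{ unfold m. rewrite S_INR, !plus_INR, mult_INR. change (INR 2) with 2. lra. }
assert (E2 : Rpower 2 (a + b + 2 * INR k - 1) = 2 ^ m).
{ rewrite <- Em, S_INR, <- Rpower_pow by lra. f_equal. ring. }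
destruct Hc as [Hc|Hc].
- assert (Edel : delta a b c d = 1 / 2) by (unfold delta; lra).
  assert (D := Gamma_duplication m). rewrite Em in D.
  replace ((a + b + 2 * INR k) / 2) with (c + INR k) in D by lra.
  replace (c + INR k + 1 / 2) with (d + INR k) in D by lra.
  rewrite Gck, Gdk in D.
  replace (poch a k * poch b k / (poch c k * poch d k)) with
    (Gamma c * Gamma d / (Gamma a * Gamma b * Gamma (1 / 2)) *
     (Rpower 2 (a + b + 2 * INR k - 1) *
      (poch a k * Gamma a * (poch b k * Gamma b) / Gamma (a + b + 2 * INR k)))).
  + apply newton_int_RInt_gen with (3 := newton_int_scal _ _ _ _
      (Gamma c * Gamma d / (Gamma a * Gamma b * Gamma (1 / 2))) _ open_interval_01
      (weight_int_1_2 a b _ k Ha Hb Hab HB)); [exact open_interval_01|].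
    intros x Hx. unfold w1, mu_density. rewrite Edel.
    replace (c - b) with ((a - b) / 2) by lra.
    replace (d - b) with ((a - b) / 2 + 1 / 2) by lra. ring.
  + rewrite E2.
    apply Rmult_eq_reg_r with (Gamma (1 / 2) * Gamma (a + b + 2 * INR k)); [|nra].
    transitivity (Gamma c * Gamma d * 2 ^ m * poch a k * poch b k); [field; lra|].
    rewrite <- D. field. lra.
- assert (Edel : delta a b c d = 3 / 2) by (unfold delta; lra).
  assert (D := Gamma_duplication (S m)).
  rewrite (S_INR (S m)), Em, Gamma_S in D by lra.
  replace ((a + b + 2 * INR k + 1) / 2) with (c + INR k) in D by lra.
  replace (c + INR k + 1 / 2) with (d + INR k) in D by lra.
  rewrite Gck, Gdk in D.
  assert (G3 : Gamma (3 / 2) = / 2 * Gamma (1 / 2)).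
  { replace (3 / 2) with (1 / 2 + 1) by field. rewrite Gamma_S by lra. field. }
  replace (poch a k * poch b k / (poch c k * poch d k)) with
    (Gamma c * Gamma d / (Gamma a * Gamma b * Gamma (3 / 2)) *
     (Rpower 2 (a + b + 2 * INR k - 1) *
      (poch a k * Gamma a * (poch b k * Gamma b) / Gamma (a + b + 2 * INR k)) / (a + b + 2 * INR k))).
  + apply newton_int_RInt_gen with (3 := newton_int_scal _ _ _ _
      (Gamma c * Gamma d / (Gamma a * Gamma b * Gamma (3 / 2))) _ open_interval_01
      (weight_int_3_2 a b _ k Ha Hb Hab HB)); [exact open_interval_01|].
    intros x Hx. unfold w1, mu_density. rewrite Edel.
    replace (c - b) with ((a - b + 1) / 2) by lra.
    replace (d - b) with ((a - b + 1) / 2 + 1 / 2) by lra. ring.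
  + rewrite E2, G3. simpl in D.
    apply Rmult_eq_reg_r with (Gamma (1 / 2) * ((a + b + 2 * INR k) * Gamma (a + b + 2 * INR k))).
    * transitivity (Gamma c * Gamma d * (2 * 2 ^ m) * poch a k * poch b k); [field; lra|].
      rewrite <- D. field. lra.
    * apply Rmult_integral_contrapositive_currified; [lra|]. nra.
Qed.

Lemma mu_int_is_ext (a b c d a' b' c' d' : R) (f g : R -> R) (v : R) :
  (forall x, 0 < x < 1 -> f x * mu_density a b c d x = g x * mu_density a' b' c' d' x) ->
  mu_int_is a b c d f v -> mu_int_is a' b' c' d' g v.
Proof.
intros E. apply is_RInt_gen_ext.
apply Filter_prod with (fun x => 0 < x < 1) (fun x => 0 < x < 1).
- unfold at_right, within. apply (filter_imp (fun x => x < 1)); [intros; lra|apply open_lt; lra].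
- unfold at_left, within. apply (filter_imp (fun x => 0 < x)); [intros; lra|apply open_gt; lra].
- intros x y Hx Hy t. simpl. intros Ht. apply E.
  assert (H1 := Rmin_glb_lt x y 0). assert (H2 := Rmax_lub_lt x y 1). lra.
Qed.

(** The measure w_2 dmu for (a, b, c, d) is w_1 dmu for (a, b+1, d, c+1): delta is the same, and c/b
    is the quotient of the Gamma prefactors. The new tuple satisfies the same relations, with the
    two cases for 2 c exchanged. *)
Lemma w2_moment (p : R) (i j k : nat) (a b c d : R) : 0 < p < 1 ->
  a = p + INR i -> b = 1 - p + INR j -> d = c + 1 / 2 ->
  2 * c = a + b \/ 2 * c = a + b + 1 -> (forall l, a - (b + 1) + INR l <> 0) ->
  mu_int_is a b c d (fun x => x ^ k * w2 a b c d x)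
    (poch a k * poch (b + 1) k / (poch (c + 1) k * poch d k)).
Proof.
intros Hp Ea Eb Ed Hc Hab.
assert (Hi := pos_INR i). assert (Hj := pos_INR j).
assert (Hb : 0 < b) by lra. assert (Hc0 : 0 < c) by (destruct Hc; lra).
rewrite (Rmult_comm (poch (c + 1) k)).
apply mu_int_is_ext with (2 := w1_moment p i (S j) k a (b + 1) d (c + 1) Hp Ea
  ltac:(rewrite S_INR; lra) ltac:(lra) ltac:(destruct Hc; [left|right]; lra) Hab).
intros x Hx. unfold w1, w2, mu_density.
replace (delta a (b + 1) d (c + 1)) with (delta a b c d) by (unfold delta; ring).
rewrite F21_sym. replace (c + 1 - (b + 1)) with (c - b) by ring.
replace (d - (b + 1)) with (d - b - 1) by ring.
rewrite !Gamma_S by assumption.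
assert (Gb := Gamma_pos b Hb). assert (Ga := Gamma_pos a ltac:(lra)).
assert (Gd := Gamma_pos (delta a b c d) ltac:(unfold delta; destruct Hc; lra)).
field. lra.
Qed.

(** * Coefficients of the polynomials e_n *)

(* e_(n-2), with e_(-2) = e_(-1) = 0: the formulas for A^(n) then also hold for n = 0 and n = 1. *)
Definition e_shift (n : nat) (x : R) : R :=
  match n with S (S m) => e (4 / 27) m x | _ => 0 end.

Lemma e_triple_shift (n : nat) (x : R) :
  e_triple (4 / 27) n x = (e_shift (S (S n)) x, e_shift (S n) x, e_shift n x).
Proof.
induction n as [|n IH]; [reflexivity|].
assert (E : e_triple (4 / 27) (S n) x =
  (fst (fst (e_triple (4 / 27) (S n) x)), e_shift (S (S n)) x, e_shift (S n) x)).
{ simpl e_triple. rewrite IH. reflexivity. }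
exact E.
Qed.

(* With kappa = 4/27: 81/4 = 3/kappa, 2187/16 = 3/kappa^2, 19683/64 = 1/kappa^3. *)
Lemma e_shift_rec (n : nat) (x : R) :
  e_shift (S (S (S n))) x =
  - (81 / 4) * e_shift (S (S n)) x + (19683 / 64 * x - 2187 / 16) * e_shift (S n) x
  - 19683 / 64 * e_shift n x.
Proof.
change (fst (fst (e_triple (4 / 27) (S n) x)) =
  - (81 / 4) * e_shift (S (S n)) x + (19683 / 64 * x - 2187 / 16) * e_shift (S n) x
  - 19683 / 64 * e_shift n x).
change (e_triple (4 / 27) (S n) x) with
  (let '(e1, e2, e3) := e_triple (4 / 27) n x in
   (- (dcoef1 (4 / 27) x * e1 + dcoef2 (4 / 27) x * e2 + dcoef3 (4 / 27) x * e3), e1, e2)).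
rewrite e_triple_shift. cbn [fst]. unfold dcoef1, dcoef2, dcoef3. field.
Qed.

Lemma e_shift_mul_x (n : nat) (x : R) :
  x * e_shift (S n) x =
  64 / 19683 * e_shift (S (S (S n))) x + 16 / 243 * e_shift (S (S n)) x +
  4 / 9 * e_shift (S n) x + e_shift n x.
Proof. rewrite (e_shift_rec n). field. Qed.

(** This is 1 / Gamma(n - j + 1), extended by 0 at the poles of Gamma, so that the rules below hold
    for all n and j. *)
Definition inv_fact_sub (n j : nat) : R := if Nat.leb j n then / INR (fact (n - j)) else 0.

Lemma inv_fact_sub_gt (n j : nat) : (n < j)%nat -> inv_fact_sub n j = 0.
Proof. intros H. unfold inv_fact_sub. now rewrite (proj2 (Nat.leb_gt j n) H). Qed.

Lemma inv_fact_sub_SS (n j : nat) : inv_fact_sub (S n) (S j) = inv_fact_sub n j.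
Proof. reflexivity. Qed.

Lemma inv_fact_sub_S (n j : nat) :
  inv_fact_sub n j = (INR n + 1 - INR j) * inv_fact_sub (S n) j.
Proof.
destruct (Nat.lt_trichotomy j (S n)) as [H|[->|H]].
- unfold inv_fact_sub. rewrite (proj2 (Nat.leb_le j n)), (proj2 (Nat.leb_le j (S n))) by lia.
  rewrite Nat.sub_succ_l by lia. rewrite INR_fact_S, S_INR, minus_INR by lia.
  assert (H1 : INR j <= INR n) by (apply le_INR; lia).
  assert (H2 := INR_fact_neq_0 (n - j)). field. split; lra.
- rewrite inv_fact_sub_gt by lia. rewrite S_INR. ring.
- rewrite !inv_fact_sub_gt by lia. ring.
Qed.

(* The coefficient (-1)^n kappa^(-n-m) binomial(n + m + 2, n - 2 m) of x^m in e_n, kappa = 4/27. *)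
Definition e_coef (n m : nat) : R :=
  (- 1) ^ n * (27 / 4) ^ (n + m) * (INR (fact (n + m + 2)) / INR (fact (3 * m + 2))) *
  inv_fact_sub n (2 * m).

(** The lower index is expressed by the higher one: in this direction the factor n + 1 - 2 m is a
    numerator, so the rule stays valid where coefficients vanish. *)
Lemma e_coef_Sn (n m : nat) :
  e_coef n m =
  - (4 / 27) * (INR n + 1 - 2 * INR m) / (INR n + INR m + 3) * e_coef (S n) m.
Proof.
unfold e_coef. rewrite (inv_fact_sub_S n), mult_INR.
replace (S n + m + 2)%nat with (S (n + m + 2)) by lia. replace (S n + m)%nat with (S (n + m)) by lia.
rewrite INR_fact_S, (S_INR (n + m + 2)), !plus_INR. change (INR 2) with 2. simpl pow.
assert (H := INR_fact_neq_0 (3 * m + 2)). assert (H1 := pos_INR n). assert (H2 := pos_INR m).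
field. split; lra.
Qed.

Lemma e_coef_SS (n m : nat) :
  e_coef (S (S n)) (S m) =
  19683 / 64 * ((INR n + INR m + 5) * (INR n + INR m + 4) * (INR n + INR m + 3)) /
  ((3 * INR m + 3) * (3 * INR m + 4) * (3 * INR m + 5)) * e_coef n m.
Proof.
unfold e_coef. replace (2 * S m)%nat with (S (S (2 * m))) by lia. rewrite !inv_fact_sub_SS.
replace (S (S n) + S m + 2)%nat with (S (S (S (n + m + 2)))) by lia.
replace (3 * S m + 2)%nat with (S (S (S (3 * m + 2)))) by lia.
replace (S (S n) + S m)%nat with (S (S (S (n + m)))) by lia.
rewrite !INR_fact_S, !S_INR, !plus_INR, mult_INR.
change (INR 3) with (2 + 1). change (INR 2) with 2. simpl pow.
assert (H := INR_fact_neq_0 (3 * m + 2)). assert (H1 := pos_INR n). assert (H2 := pos_INR m).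
field. repeat split; lra.
Qed.

Lemma e_coef_gt (n m : nat) : (n < 2 * m)%nat -> e_coef n m = 0.
Proof. intros H. unfold e_coef. rewrite inv_fact_sub_gt by assumption. ring. Qed.

Definition e_shift_coef (n m : nat) : R :=
  match n with S (S n') => e_coef n' m | _ => 0 end.

Lemma e_coef_0_0 : e_coef 0 0 = 1.
Proof. unfold e_coef, inv_fact_sub. simpl. field. Qed.

(** The closed form comes from the geometric series sum_m x^m t^(2m) kappa^(-3m) (1 +
    t/kappa)^(-3m-3). It is justified by checking the recurrence of the e_n on coefficients, with
    the first two indices apart because there some terms are 0 by convention. *)
Lemma e_shift_coef_rec_0 (n : nat) :
  e_shift_coef (S (S (S n))) 0 =
  - (81 / 4) * e_shift_coef (S (S n)) 0 - 2187 / 16 * e_shift_coef (S n) 0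
  - 19683 / 64 * e_shift_coef n 0.
Proof.
assert (E1 : e_coef 1 0 = - (81 / 4)) by (unfold e_coef, inv_fact_sub; simpl; field).
destruct n as [|[|n]]; simpl e_shift_coef.
- rewrite E1, e_coef_0_0. ring.
- assert (H := e_coef_Sn 1 0). rewrite E1 in H. simpl in H. rewrite E1, e_coef_0_0.
  lra.
- rewrite (e_coef_Sn n), (e_coef_Sn (S n)), (e_coef_Sn (S (S n))).
  rewrite !S_INR. change (INR 0) with 0. assert (H1 := pos_INR n). field. repeat split; lra.
Qed.

Lemma e_shift_coef_rec_S (n m : nat) :
  e_shift_coef (S (S (S n))) (S m) =
  - (81 / 4) * e_shift_coef (S (S n)) (S m) - 2187 / 16 * e_shift_coef (S n) (S m)
  + 19683 / 64 * e_shift_coef (S n) m - 19683 / 64 * e_shift_coef n (S m).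
Proof.
destruct n as [|[|n]]; simpl e_shift_coef.
- rewrite !e_coef_gt by lia. ring.
- rewrite (e_coef_gt 1), (e_coef_gt 0 (S m)) by lia. rewrite e_coef_SS.
  destruct m as [|m].
  + simpl. field.
  + rewrite e_coef_gt by lia. ring.
- assert (H1 := pos_INR n). assert (H2 := pos_INR m).
  rewrite (e_coef_Sn n (S m)), (e_coef_Sn (S n) (S m)), (e_coef_Sn (S (S n)) (S m)).
  rewrite (e_coef_SS (S n)). rewrite !S_INR. field. repeat split; lra.
Qed.

Lemma sum_f_R0_first (f : nat -> R) (M : nat) :
  (forall m, f (S m) = 0) -> sum_f_R0 f M = f 0%nat.
Proof. intros H. induction M as [|M IH]; [reflexivity|]. simpl. rewrite IH, H. ring. Qed.

Lemma sum_f_R0_scal (f : nat -> R) (c : R) (M : nat) :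
  sum_f_R0 (fun m => c * f m) M = c * sum_f_R0 f M.
Proof. rewrite scal_sum. apply sum_eq. intros. apply Rmult_comm. Qed.

(** Three consecutive indices are treated together because the recurrence has order 3. The upper
    bound [M] is left free so that sums of different degrees can be merged termwise. *)
Lemma e_shift_sum_aux (n : nat) (x : R) :
  (forall M, (n <= M)%nat -> e_shift n x = sum_f_R0 (fun m => e_shift_coef n m * x ^ m) M) /\
  (forall M, (S n <= M)%nat -> e_shift (S n) x = sum_f_R0 (fun m => e_shift_coef (S n) m * x ^ m) M) /\
  (forall M, (S (S n) <= M)%nat ->
     e_shift (S (S n)) x = sum_f_R0 (fun m => e_shift_coef (S (S n)) m * x ^ m) M).
Proof.
induction n as [|n [IH0 [IH1 IH2]]].
- repeat split; intros M _; rewrite sum_f_R0_first; simpl e_shift_coef; simpl e_shift;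
    try (intros; simpl; ring).
  + rewrite e_coef_0_0. unfold e. simpl. ring.
  + intros m. rewrite e_coef_gt by lia. ring.
- split; [exact IH1|]. split; [exact IH2|].
  intros [|M] HM; [lia|].
  rewrite e_shift_rec, (IH2 (S M)), (IH0 (S M)) by lia.
  replace ((19683 / 64 * x - 2187 / 16) * e_shift (S n) x) with
    (19683 / 64 * x * e_shift (S n) x - 2187 / 16 * e_shift (S n) x) by ring.
  (* The copy of e_shift (S n) that is multiplied by x is expanded only up to [M], since the factor
     x shifts its terms to 1, ..., M + 1. *)
  rewrite (IH1 (S M)) at 2 by lia. rewrite (IH1 M) by lia.
  rewrite !(decomp_sum _ (S M)) by lia. simpl pred.
  rewrite e_shift_coef_rec_0.
  rewrite (sum_eq (fun i => e_shift_coef (S (S (S n))) (S i) * x ^ S i)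
    (fun i => - (81 / 4) * (e_shift_coef (S (S n)) (S i) * x ^ S i)
      + (- 2187 / 16) * (e_shift_coef (S n) (S i) * x ^ S i)
      + 19683 / 64 * x * (e_shift_coef (S n) i * x ^ i)
      + (- 19683 / 64) * (e_shift_coef n (S i) * x ^ S i))).
  + rewrite !plus_sum, !sum_f_R0_scal. simpl pow. field.
  + intros i _. rewrite e_shift_coef_rec_S. simpl. field.
Qed.

(** * Orthogonality *)

Lemma mu_int_is_lin (a b c d u v al be : R) (f g : R -> R) :
  mu_int_is a b c d f u -> mu_int_is a b c d g v ->
  mu_int_is a b c d (fun x => al * f x + be * g x) (al * u + be * v).
Proof.
intros Hf Hg.
apply (is_RInt_gen_scal _ al) in Hf. apply (is_RInt_gen_scal _ be) in Hg.
generalize (is_RInt_gen_plus _ _ _ _ Hf Hg). apply is_RInt_gen_ext.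
apply filter_forall. intros ab x _. unfold plus, scal; simpl; unfold mult; simpl. ring.
Qed.

Lemma mu_int_is_eq (a b c d u v : R) (f g : R -> R) :
  (forall x, f x = g x) -> u = v -> mu_int_is a b c d f u -> mu_int_is a b c d g v.
Proof. intros H <-. apply mu_int_is_ext. intros x _. now rewrite H. Qed.

Lemma mu_int_is_unique (a b c d u v : R) (f : R -> R) :
  mu_int_is a b c d f u -> mu_int_is a b c d f v -> u = v.
Proof.
intros Hu Hv.
rewrite <- (is_RInt_gen_unique (V := R_CompleteNormedModule) _ _ Hu).
exact (is_RInt_gen_unique (V := R_CompleteNormedModule) _ _ Hv).
Qed.

Lemma mu_int_is_sum (a b c d : R) (w : R -> R) (m co : nat -> R) (M : nat) :
  (forall k, mu_int_is a b c d (fun x => x ^ k * w x) (m k)) ->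
  mu_int_is a b c d (fun x => sum_f_R0 (fun k => co k * x ^ k) M * w x)
    (sum_f_R0 (fun k => co k * m k) M).
Proof.
intros Hm. induction M as [|M IH].
- apply mu_int_is_eq with (3 := mu_int_is_lin _ _ _ _ _ _ (co 0%nat) 0 _ _ (Hm 0%nat) (Hm 0%nat)).
  + intros x. simpl. ring.
  + simpl. ring.
- apply mu_int_is_eq with (3 := mu_int_is_lin _ _ _ _ _ _ 1 (co (S M)) _ _ IH (Hm (S M))).
  + intros x. simpl. ring.
  + simpl. ring.
Qed.

(** The candidate A_1 of index n: the three terms are e_(n-2), e_(n-1), e_n, and e_n has coefficient
    1. *)
Definition combA1 (al0 alx al1 : R) (n : nat) (x : R) : R :=
  (al0 + alx * x) * e_shift n x + al1 * e_shift (S n) x + e_shift (S (S n)) x.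

Definition combA2 (be0 be1 : R) (n : nat) (x : R) : R :=
  be0 * e_shift n x + be1 * e_shift (S n) x.

Definition linear_form (a b c d : R) (U1 U2 : R -> R) (x : R) : R :=
  U1 x * w1 a b c d x + U2 x * w2 a b c d x.

Definition has_moments (a b c d : R) (m1 m2 : nat -> R) : Prop :=
  (forall k, mu_int_is a b c d (fun x => x ^ k * w1 a b c d x) (m1 k)) /\
  (forall k, mu_int_is a b c d (fun x => x ^ k * w2 a b c d x) (m2 k)).

Definition moment_term (al0 alx al1 be0 be1 : R) (m1 m2 : nat -> R) (n m : nat) : R :=
  m1 m * (e_coef (S (S n)) m + al1 * e_coef (S n) m + al0 * e_coef n m) +
  alx * (m1 (S m) * e_coef n m) +
  m2 m * (be1 * e_coef (S n) m + be0 * e_coef n m).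

(** Index 0 gives the form w_1, of mass 1. Index 1 gives (al1 - 81/4) w_1 + be1 w_2, of mass 0 by
    the condition on al1 + be1. From index 2 on, expanding in monomials turns the mass into the sum
    in the last hypothesis. *)
Lemma linear_form_mass (a b c d al0 alx al1 be0 be1 : R) (m1 m2 : nat -> R) (n : nat) :
  has_moments a b c d m1 m2 -> m1 0%nat = 1 -> m2 0%nat = 1 -> al1 + be1 = 81 / 4 ->
  (forall n, sum_f_R0 (moment_term al0 alx al1 be0 be1 m1 m2 n) (S (S n)) = 0) ->
  mu_int_is a b c d (linear_form a b c d (combA1 al0 alx al1 n) (combA2 be0 be1 n))
    (match n with O => 1 | _ => 0 end).
Proof.
intros [H1 H2] m10 m20 Hab HT.
assert (E2 : forall x, e_shift 2 x = 1) by (intros x; unfold e_shift, e; reflexivity).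
assert (E3 : forall x, e_shift 3 x = - (81 / 4)).
{ intros x. rewrite e_shift_rec, E2. simpl. ring. }
destruct n as [|[|n]].
- apply mu_int_is_eq with (3 := mu_int_is_lin _ _ _ _ _ _ 1 0 _ _ (H1 0%nat) (H2 0%nat)).
  + intros x. unfold linear_form, combA1, combA2. rewrite E2. simpl. ring.
  + rewrite m10. ring.
- apply mu_int_is_eq with (3 := mu_int_is_lin _ _ _ _ _ _ (al1 - 81 / 4) be1 _ _ (H1 0%nat) (H2 0%nat)).
  + intros x. unfold linear_form, combA1, combA2. rewrite E2, E3. simpl. ring.
  + rewrite m10, m20. lra.
- set (M := (S (S n))).
  assert (Hx : forall k, mu_int_is a b c d (fun x => x ^ k * (x * w1 a b c d x)) (m1 (S k))).
  { intros k. apply mu_int_is_eq with (3 := H1 (S k)); [|reflexivity]. intros x. simpl. ring. }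
  assert (S0 := fun x => proj1 (e_shift_sum_aux (S (S n)) x) (S (S M)) ltac:(lia)).
  assert (S1 := fun x => proj1 (proj2 (e_shift_sum_aux (S (S n)) x)) (S (S M)) ltac:(lia)).
  assert (S2 := fun x => proj2 (proj2 (e_shift_sum_aux (S (S n)) x)) (S (S M)) ltac:(lia)).
  simpl e_shift_coef in S0, S1, S2.
  assert (I1 := mu_int_is_sum a b c d (w1 a b c d) m1
    (fun m => e_coef (S (S n)) m + al1 * e_coef (S n) m + al0 * e_coef n m) (S (S M)) H1).
  assert (I2 := mu_int_is_sum a b c d (fun x => x * w1 a b c d x) (fun k => m1 (S k))
    (fun m => alx * e_coef n m) (S (S M)) Hx).
  assert (I3 := mu_int_is_sum a b c d (w2 a b c d) m2
    (fun m => be1 * e_coef (S n) m + be0 * e_coef n m) (S (S M)) H2).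
  assert (I := mu_int_is_lin _ _ _ _ _ _ 1 1 _ _ (mu_int_is_lin _ _ _ _ _ _ 1 1 _ _ I1 I2) I3).
  apply mu_int_is_eq with (3 := I).
  + intros x. unfold linear_form, combA1, combA2. rewrite S0, S1, S2.
    rewrite (sum_eq (fun k => (e_coef (S (S n)) k + al1 * e_coef (S n) k + al0 * e_coef n k) * x ^ k)
      (fun k => e_coef (S (S n)) k * x ^ k + al1 * (e_coef (S n) k * x ^ k) + al0 * (e_coef n k * x ^ k)))
      by (intros; ring).
    rewrite (sum_eq (fun k => alx * e_coef n k * x ^ k) (fun k => alx * (e_coef n k * x ^ k)))
      by (intros; ring).
    rewrite (sum_eq (fun k => (be1 * e_coef (S n) k + be0 * e_coef n k) * x ^ k)
      (fun k => be1 * (e_coef (S n) k * x ^ k) + be0 * (e_coef n k * x ^ k))) by (intros; ring).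
    rewrite !plus_sum, !sum_f_R0_scal. ring.
  + rewrite !Rmult_1_l, <- !plus_sum. rewrite <- (HT n).
    transitivity (sum_f_R0 (moment_term al0 alx al1 be0 be1 m1 m2 n) (S (S M))).
    { apply sum_eq. intros. unfold moment_term. ring. }
    (* The expansions run two terms further than the hypothesis [HT]; these two vanish, as there 2 m
       exceeds n + 2. *)
    unfold M. rewrite 2 (tech5 _ (S _)). unfold moment_term. rewrite !e_coef_gt by lia. ring.
Qed.

Lemma linear_form_orthogonal (a b c d al0 alx al1 be0 be1 : R) :
  (forall n, mu_int_is a b c d (linear_form a b c d (combA1 al0 alx al1 n) (combA2 be0 be1 n))
    (match n with O => 1 | _ => 0 end)) ->
  forall k n, (k <= n)%nat ->
  mu_int_is a b c d
    (fun x => x ^ k * linear_form a b c d (combA1 al0 alx al1 n) (combA2 be0 be1 n) x)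
    (if Nat.eqb k n then 1 else 0).
Proof.
intros H0 k. set (q := fun n => linear_form a b c d (combA1 al0 alx al1 n) (combA2 be0 be1 n)).
change (forall n, (k <= n)%nat -> mu_int_is a b c d (fun x => x ^ k * q n x) (if Nat.eqb k n then 1 else 0)).
induction k as [|k IH]; intros n Hn.
- apply mu_int_is_eq with (3 := H0 n).
  + intros x. simpl. unfold q. ring.
  + now destruct n.
(* Multiplication by x lowers the index by at most one, so k + 1 <= n + 1 leaves every form in the
   range of the induction hypothesis; only the form of index n can contribute 1. *)
- destruct n as [|n]; [lia|].
  assert (E : forall x, x * q (S n) x = 64 / 19683 * q (S (S (S n))) x + 16 / 243 * q (S (S n)) x +
    4 / 9 * q (S n) x + q n x).
  { intros x. unfold q, linear_form, combA1, combA2.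
    transitivity (((al0 + alx * x) * (x * e_shift (S n) x) + al1 * (x * e_shift (S (S n)) x) +
        x * e_shift (S (S (S n))) x) * w1 a b c d x +
      (be0 * (x * e_shift (S n) x) + be1 * (x * e_shift (S (S n)) x)) * w2 a b c d x); [ring|].
    rewrite (e_shift_mul_x n), (e_shift_mul_x (S n)), (e_shift_mul_x (S (S n))). field. }
  assert (I3 := IH (S (S (S n))) ltac:(lia)). assert (I2 := IH (S (S n)) ltac:(lia)).
  assert (I1 := IH (S n) ltac:(lia)). assert (I0 := IH n ltac:(lia)).
  apply mu_int_is_eq with (3 := mu_int_is_lin _ _ _ _ _ _ 1 1 _ _
    (mu_int_is_lin _ _ _ _ _ _ (64 / 19683) (16 / 243) _ _ I3 I2)
    (mu_int_is_lin _ _ _ _ _ _ (4 / 9) 1 _ _ I1 I0)).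
  + intros x. simpl pow. transitivity (x ^ k * (x * q (S n) x)); [rewrite E; ring|ring].
  + simpl Nat.eqb.
    assert (F : forall l, (k < l)%nat -> Nat.eqb k l = false) by (intros; apply Nat.eqb_neq; lia).
    rewrite (F (S n)), (F (S (S n))), (F (S (S (S n)))) by lia. ring.
Qed.

(** * Degrees and uniqueness *)

(** Degrees are bounded strictly so that the zero polynomial is the case m = 0, and the leading
    coefficient is exposed as the witness that the uniqueness proof cancels. *)
Fixpoint poly_deg_lt (m : nat) (f : R -> R) : Prop :=
  match m with
  | O => forall x, f x = 0
  | S m' => exists l, poly_deg_lt m' (fun x => f x - l * x ^ m')
  end.

Lemma poly_deg_lt_ext (m : nat) (f g : R -> R) :
  (forall x, f x = g x) -> poly_deg_lt m f -> poly_deg_lt m g.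
Proof.
revert f g. induction m as [|m IH]; intros f g E; simpl.
- intros H x. now rewrite <- E.
- intros [l H]. exists l. revert H. apply IH. intros x. now rewrite E.
Qed.

Lemma poly_deg_lt_lin (m : nat) (f g : R -> R) (al be : R) :
  poly_deg_lt m f -> poly_deg_lt m g -> poly_deg_lt m (fun x => al * f x + be * g x).
Proof.
revert f g. induction m as [|m IH]; intros f g; simpl.
- intros Hf Hg x. rewrite Hf, Hg. ring.
- intros [l Hf] [l' Hg]. exists (al * l + be * l').
  apply poly_deg_lt_ext with (2 := IH _ _ Hf Hg). intros x. ring.
Qed.

Lemma poly_deg_lt_S (m : nat) (f : R -> R) : poly_deg_lt m f -> poly_deg_lt (S m) f.
Proof. intros H. exists 0. apply poly_deg_lt_ext with (2 := H). intros x. ring. Qed.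

Lemma poly_deg_lt_0 (m : nat) : poly_deg_lt m (fun _ => 0).
Proof. induction m as [|m IH]; [intros x; reflexivity|now apply poly_deg_lt_S]. Qed.

Lemma poly_deg_lt_mul_x (m : nat) (f : R -> R) :
  poly_deg_lt m f -> poly_deg_lt (S m) (fun x => x * f x).
Proof.
revert f. induction m as [|m IH]; intros f.
- intros H. apply poly_deg_lt_ext with (2 := poly_deg_lt_0 1). intros x.
  simpl in H. rewrite H. ring.
- intros [l H]. exists l. apply poly_deg_lt_ext with (2 := IH _ H). intros x. simpl. ring.
Qed.

Lemma poly_deg_lt_monomial (m : nat) (l : R) (f : R -> R) :
  poly_deg_lt m (fun x => f x - l * x ^ m) -> poly_deg_lt (S m) f.
Proof. intros H. now exists l. Qed.

Lemma poly_deg_le_lt (m : nat) (f : R -> R) : poly_deg_le m f <-> poly_deg_lt (S m) f.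
Proof.
split.
- intros [co H]. apply poly_deg_lt_ext with (f := fun x => sum_f_R0 (fun i => co i * x ^ i) m);
    [intros x; now rewrite H|]. clear H.
  induction m as [|m IH].
  + exists (co 0%nat). intros x. simpl. ring.
  + exists (co (S m)). apply poly_deg_lt_ext with (2 := IH). intros x. simpl. ring.
- revert f. induction m as [|m IH]; intros f.
  + intros [l H]. exists (fun _ => l). intros x. specialize (H x). simpl in *. lra.
  + intros [l H]. destruct (IH _ H) as [co Hco].
    exists (fun i => if Nat.eqb i (S m) then l else co i). intros x.
    rewrite tech5, Nat.eqb_refl.
    rewrite (sum_eq _ (fun i => co i * x ^ i)).
    * rewrite <- Hco. ring.
    * intros i Hi. now rewrite (proj2 (Nat.eqb_neq i (S m))) by lia.
Qed.

(** Only the term x / kappa^3 of the recurrence raises the degree, once in two steps; hence e_(2m)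
    has leading term (x / kappa^3)^m. *)
Lemma e_shift_degree (m : nat) :
  poly_deg_lt m (e_shift (2 * m)) /\ poly_deg_lt m (e_shift (2 * m + 1)) /\
  poly_deg_lt m (fun x => e_shift (2 * m + 2) x - (19683 / 64) ^ m * x ^ m).
Proof.
induction m as [|m [IH0 [IH1 IH2]]].
- repeat split; intros x; try reflexivity. unfold e_shift, e. simpl. ring.
- assert (D2 := poly_deg_lt_monomial _ _ _ IH2).
  replace (2 * S m)%nat with (2 * m + 2)%nat by lia.
  replace (2 * m + 2 + 1)%nat with (S (S (S (2 * m)))) by lia.
  replace (2 * m + 2 + 2)%nat with (S (S (S (2 * m + 1)))) by lia.
  replace (2 * m + 1)%nat with (S (2 * m)) in * by lia.
  replace (2 * m + 2)%nat with (S (S (2 * m))) in * by lia.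
  assert (D3 : poly_deg_lt (S m) (e_shift (S (S (S (2 * m)))))).
  { apply poly_deg_lt_ext with (fun x => 1 * (- (81 / 4) * e_shift (S (S (2 * m))) x +
      19683 / 64 * (x * e_shift (S (2 * m)) x)) + 1 * (- (2187 / 16) * e_shift (S (2 * m)) x +
      - (19683 / 64) * e_shift (2 * m) x)).
    - intros x. rewrite e_shift_rec. field.
    - apply poly_deg_lt_lin; apply poly_deg_lt_lin; try assumption;
        try (now apply poly_deg_lt_S). now apply poly_deg_lt_mul_x. }
  split; [exact D2|]. split; [exact D3|].
  apply poly_deg_lt_ext with (fun x => 1 * (- (81 / 4) * e_shift (S (S (S (2 * m)))) x +
      19683 / 64 * (x * (e_shift (S (S (2 * m))) x - (19683 / 64) ^ m * x ^ m))) +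
      1 * (- (2187 / 16) * e_shift (S (S (2 * m))) x + - (19683 / 64) * e_shift (S (2 * m)) x)).
  + intros x. rewrite (e_shift_rec (S (2 * m))). simpl pow. field.
  + apply poly_deg_lt_lin; apply poly_deg_lt_lin; try assumption;
      try (now apply poly_deg_lt_S). now apply poly_deg_lt_mul_x.
Qed.

(** In A_2 of index 2 m + 1 the term be1 e_(2m) dominates, so be1 <> 0 makes its leading coefficient
    nonzero. *)
Lemma combA_degree_odd (al0 alx al1 be0 be1 : R) (m : nat) :
  poly_deg_lt (S m) (combA1 al0 alx al1 (2 * m + 1)) /\
  poly_deg_lt m (fun x => combA2 be0 be1 (2 * m + 1) x - be1 * (19683 / 64) ^ m * x ^ m).
Proof.
destruct (e_shift_degree m) as [H0 [H1 H2]].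
destruct (e_shift_degree (S m)) as [K0 [K1 _]].
replace (2 * S m)%nat with (2 * m + 2)%nat in * by lia.
replace (2 * m + 2 + 1)%nat with (S (S (2 * m + 1))) in * by lia.
replace (2 * m + 2)%nat with (S (2 * m + 1)) in * by lia. split.
- apply poly_deg_lt_ext with (fun x => 1 * (al0 * e_shift (2 * m + 1) x + alx * (x * e_shift (2 * m + 1) x)) +
    1 * (al1 * e_shift (S (2 * m + 1)) x + 1 * e_shift (S (S (2 * m + 1))) x)).
  + intros x. unfold combA1. ring.
  + apply poly_deg_lt_lin; apply poly_deg_lt_lin; try assumption;
      [now apply poly_deg_lt_S|now apply poly_deg_lt_mul_x].
- apply poly_deg_lt_ext with (fun x => be0 * e_shift (2 * m + 1) x +
    be1 * (e_shift (S (2 * m + 1)) x - (19683 / 64) ^ m * x ^ m)).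
  + intros x. unfold combA2. ring.
  + now apply poly_deg_lt_lin.
Qed.

(** In A_1 of index 2 m both e_(2m) and alx x e_(2m-2) reach degree m. For m > 0 the leading
    coefficient is (kappa^(-3) + alx) kappa^(-3(m-1)), whence the hypothesis; for m = 0 the second
    term is absent. *)
Lemma combA_degree_even (al0 alx al1 be0 be1 : R) (m : nat) : 19683 / 64 + alx <> 0 ->
  (exists l, l <> 0 /\ poly_deg_lt m (fun x => combA1 al0 alx al1 (2 * m) x - l * x ^ m)) /\
  poly_deg_lt m (combA2 be0 be1 (2 * m)).
Proof.
intros Hx. destruct (e_shift_degree m) as [H0 [H1 H2]].
replace (2 * m + 2)%nat with (S (S (2 * m))) in * by lia.
replace (2 * m + 1)%nat with (S (2 * m)) in * by lia. split.
- assert (HX : exists l, l + (19683 / 64) ^ m <> 0 /\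
    poly_deg_lt m (fun x => alx * (x * e_shift (2 * m) x) - l * x ^ m)).
  { destruct m as [|m].
    - exists 0. split; [simpl; lra|]. intros x. simpl. ring.
    - exists (alx * (19683 / 64) ^ m). split.
      + replace (alx * (19683 / 64) ^ m + (19683 / 64) ^ S m) with
          ((19683 / 64 + alx) * (19683 / 64) ^ m) by (simpl; ring).
        apply Rmult_integral_contrapositive_currified; [assumption|apply pow_nonzero; lra].
      + destruct (e_shift_degree m) as [_ [_ K]].
        replace (2 * m + 2)%nat with (2 * S m)%nat in K by lia.
        apply poly_deg_lt_mul_x in K.
        apply poly_deg_lt_ext with (2 := poly_deg_lt_lin _ _ _ alx 0 K K).
        intros x. simpl pow. ring. }
  destruct HX as [l [Hl HX]]. exists (l + (19683 / 64) ^ m). split; [exact Hl|].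
  apply poly_deg_lt_ext with (fun x => 1 * (al0 * e_shift (2 * m) x + al1 * e_shift (S (2 * m)) x) +
    1 * (1 * (alx * (x * e_shift (2 * m) x) - l * x ^ m) +
         1 * (e_shift (S (S (2 * m))) x - (19683 / 64) ^ m * x ^ m))).
  + intros x. unfold combA1. ring.
  + apply poly_deg_lt_lin; now apply poly_deg_lt_lin.
- apply poly_deg_lt_lin; assumption.
Qed.

Definition orthogonal_below (a b c d : R) (N : nat) (U1 U2 : R -> R) : Prop :=
  forall k, (k < N)%nat -> mu_int_is a b c d (fun x => x ^ k * linear_form a b c d U1 U2 x) 0.

Lemma poly_deg_lt_cancel (m : nat) (f g : R -> R) (lf lg : R) :
  lg <> 0 -> poly_deg_lt m (fun x => f x - lf * x ^ m) -> poly_deg_lt m (fun x => g x - lg * x ^ m) ->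
  poly_deg_lt m (fun x => f x - lf / lg * g x).
Proof.
intros Hl Hf Hg. apply poly_deg_lt_ext with (2 := poly_deg_lt_lin _ _ _ 1 (- (lf / lg)) Hf Hg).
intros x. field. exact Hl.
Qed.

(* The forms q^(0), ..., q^(N) have a triangular moment matrix with unit diagonal, and span the
   forms of index N: a multiple of q^(N) removes the leading coefficient. *)
Lemma orthogonal_zero_step (a b c d : R) (A1 A2 U1 U2 : R -> R) (N : nat) (g : R) :
  orthogonal_below a b c d N A1 A2 ->
  mu_int_is a b c d (fun x => x ^ N * linear_form a b c d A1 A2 x) 1 ->
  orthogonal_below a b c d (S N) U1 U2 ->
  (orthogonal_below a b c d N (fun x => U1 x - g * A1 x) (fun x => U2 x - g * A2 x) ->
   (forall x, U1 x - g * A1 x = 0) /\ (forall x, U2 x - g * A2 x = 0)) ->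
  (forall x, U1 x = 0) /\ (forall x, U2 x = 0).
Proof.
intros HA HN HU IH. destruct IH as [E1 E2].
{ intros k Hk.
  apply mu_int_is_eq with (3 := mu_int_is_lin _ _ _ _ _ _ 1 (- g) _ _ (HU k ltac:(lia)) (HA k Hk)).
  - intros x. unfold linear_form. ring.
  - ring. }
(* U is now g times the form of index N, so its N-th moment is g; it is also 0, since U is
   orthogonal to x^N as well. *)
assert (g0 : g * 1 + 0 * 1 = 0).
{ apply mu_int_is_unique with (2 := HU N ltac:(lia)).
  apply mu_int_is_eq with (3 := mu_int_is_lin _ _ _ _ _ _ g 0 _ _ HN HN); [|reflexivity].
  intros x. unfold linear_form. specialize (E1 x). specialize (E2 x).
  replace (U1 x) with (g * A1 x) by lra. replace (U2 x) with (g * A2 x) by lra. ring. }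
assert (g = 0) by lra. subst g.
split; intros x; [specialize (E1 x)|specialize (E2 x)]; lra.
Qed.

Lemma orthogonal_zero (a b c d al0 alx al1 be0 be1 : R) :
  19683 / 64 + alx <> 0 -> be1 <> 0 ->
  (forall n, orthogonal_below a b c d n (combA1 al0 alx al1 n) (combA2 be0 be1 n) /\
    mu_int_is a b c d
      (fun x => x ^ n * linear_form a b c d (combA1 al0 alx al1 n) (combA2 be0 be1 n) x) 1) ->
  forall m,
  (forall U1 U2, poly_deg_lt (S m) U1 -> poly_deg_lt m U2 ->
   orthogonal_below a b c d (S (2 * m)) U1 U2 -> (forall x, U1 x = 0) /\ (forall x, U2 x = 0)) /\
  (forall U1 U2, poly_deg_lt (S m) U1 -> poly_deg_lt (S m) U2 ->
   orthogonal_below a b c d (S (2 * m + 1)) U1 U2 -> (forall x, U1 x = 0) /\ (forall x, U2 x = 0)).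
Proof.
intros Hx Hb Horth.
(* The two steps take the preceding index as a hypothesis: [Heven] lowers the degree of the first
   component, [Hodd] that of the second. The chain starts at m = 0, where both components have
   degree < 0. *)
assert (Heven : forall m,
  (forall U1 U2, poly_deg_lt m U1 -> poly_deg_lt m U2 ->
   orthogonal_below a b c d (2 * m) U1 U2 -> (forall x, U1 x = 0) /\ (forall x, U2 x = 0)) ->
  forall U1 U2, poly_deg_lt (S m) U1 -> poly_deg_lt m U2 ->
   orthogonal_below a b c d (S (2 * m)) U1 U2 -> (forall x, U1 x = 0) /\ (forall x, U2 x = 0)).
{ intros m IH U1 U2 [l D1] D2 HU.
  destruct (combA_degree_even al0 alx al1 be0 be1 m Hx) as [[la [Hla DA1]] DA2].
  destruct (Horth (2 * m)%nat) as [HA HN].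
  apply (orthogonal_zero_step a b c d _ _ U1 U2 _ (l / la) HA HN HU).
  apply IH; [now apply poly_deg_lt_cancel|].
  apply poly_deg_lt_ext with (2 := poly_deg_lt_lin _ _ _ 1 (- (l / la)) D2 DA2). intros x. ring. }
assert (Hodd : forall m,
  (forall U1 U2, poly_deg_lt (S m) U1 -> poly_deg_lt m U2 ->
   orthogonal_below a b c d (S (2 * m)) U1 U2 -> (forall x, U1 x = 0) /\ (forall x, U2 x = 0)) ->
  forall U1 U2, poly_deg_lt (S m) U1 -> poly_deg_lt (S m) U2 ->
   orthogonal_below a b c d (S (2 * m + 1)) U1 U2 -> (forall x, U1 x = 0) /\ (forall x, U2 x = 0)).
{ intros m IH U1 U2 D1 [l D2] HU.
  destruct (combA_degree_odd al0 alx al1 be0 be1 m) as [DA1 DA2].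
  assert (Hla : be1 * (19683 / 64) ^ m <> 0).
  { apply Rmult_integral_contrapositive_currified; [assumption|apply pow_nonzero; lra]. }
  destruct (Horth (2 * m + 1)%nat) as [HA HN].
  apply (orthogonal_zero_step a b c d _ _ U1 U2 _ (l / (be1 * (19683 / 64) ^ m)) HA HN HU).
  replace (2 * m + 1)%nat with (S (2 * m)) in * by lia.
  apply IH; [|now apply poly_deg_lt_cancel].
  apply poly_deg_lt_ext with
    (2 := poly_deg_lt_lin _ _ _ 1 (- (l / (be1 * (19683 / 64) ^ m))) D1 DA1). intros x. ring. }
intros m. induction m as [|m [_ IH]].
- assert (HE := Heven 0%nat ltac:(intros U1 U2 D1 D2 _; now split)).
  split; [exact HE|exact (Hodd 0%nat HE)].
- replace (S (2 * m + 1)) with (2 * S m)%nat in IH by lia.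
  assert (HE := Heven (S m) IH). split; [exact HE|exact (Hodd (S m) HE)].
Qed.

(** For uniqueness, the difference of two solutions of index N = n + 2 is orthogonal to x^N too,
    both N-th moments being 1, so [orthogonal_zero] applies to it. *)
Lemma typeI_is_comb (a b c d al0 alx al1 be0 be1 : R) (m1 m2 : nat -> R) (n : nat) (P1 P2 : R -> R) :
  has_moments a b c d m1 m2 -> m1 0%nat = 1 -> m2 0%nat = 1 -> al1 + be1 = 81 / 4 ->
  19683 / 64 + alx <> 0 -> be1 <> 0 ->
  (forall n, sum_f_R0 (moment_term al0 alx al1 be0 be1 m1 m2 n) (S (S n)) = 0) ->
  (forall x, P1 x = (al0 + alx * x) * e (4 / 27) n x + al1 * e (4 / 27) (n + 1) x + e (4 / 27) (n + 2) x) ->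
  (forall x, P2 x = be0 * e (4 / 27) n x + be1 * e (4 / 27) (n + 1) x) ->
  typeI_is a b c d (n + 2) P1 P2.
Proof.
intros Hm m10 m20 Hab Hx Hb HT E1 E2.
assert (L := linear_form_orthogonal a b c d al0 alx al1 be0 be1
  (fun n => linear_form_mass a b c d al0 alx al1 be0 be1 m1 m2 n Hm m10 m20 Hab HT)).
assert (Horth : forall n, orthogonal_below a b c d n (combA1 al0 alx al1 n) (combA2 be0 be1 n) /\
    mu_int_is a b c d
      (fun x => x ^ n * linear_form a b c d (combA1 al0 alx al1 n) (combA2 be0 be1 n) x) 1).
{ intros N. split.
  - intros k Hk. assert (Lk := L k N ltac:(lia)).
    now rewrite (proj2 (Nat.eqb_neq k N)) in Lk by lia.
  - assert (LN := L N N ltac:(lia)). now rewrite Nat.eqb_refl in LN. }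
assert (Z := orthogonal_zero a b c d al0 alx al1 be0 be1 Hx Hb Horth).
assert (F1 : forall x, combA1 al0 alx al1 (n + 2) x = P1 x).
{ intros x. rewrite E1. rewrite !(Nat.add_comm n). reflexivity. }
assert (F2 : forall x, combA2 be0 be1 (n + 2) x = P2 x).
{ intros x. rewrite E2. rewrite !(Nat.add_comm n). reflexivity. }
destruct (Horth (n + 2)%nat) as [Ho Hn].
assert (HtypeI : forall A1 A2, typeI a b c d (n + 2) A1 A2 <->
  poly_deg_lt (S (Nat.div (n + 2) 2)) A1 /\ poly_deg_lt (S (Nat.div (n + 1) 2)) A2 /\
  orthogonal_below a b c d (n + 2) A1 A2 /\
  mu_int_is a b c d (fun x => x ^ (n + 2) * linear_form a b c d A1 A2 x) 1).
(* Turning n + 2 into 2 + n lets the match on the index reduce, with predecessor n + 1. *)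
{ intros A1 A2. unfold typeI. rewrite !(Nat.add_comm n). cbn [Nat.add].
  rewrite !poly_deg_le_lt. reflexivity. }
assert (Deg : poly_deg_lt (S (Nat.div (n + 2) 2)) (combA1 al0 alx al1 (n + 2)) /\
  poly_deg_lt (S (Nat.div (n + 1) 2)) (combA2 be0 be1 (n + 2))).
{ destruct (Nat.Even_or_Odd n) as [[m ->]|[m ->]].
  - replace (2 * m + 2)%nat with (2 * S m)%nat by lia.
    replace (2 * m + 1)%nat with (1 + m * 2)%nat by lia.
    rewrite Nat.div_add, (Nat.mul_comm 2), Nat.div_mul by lia.
    rewrite (Nat.mul_comm _ 2).
    destruct (combA_degree_even al0 alx al1 be0 be1 (S m) Hx) as [[l [_ D1]] D2].
    split; [now exists l|exact D2].
  - replace (2 * m + 1 + 2)%nat with (1 + S m * 2)%nat by lia.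
    replace (2 * m + 1 + 1)%nat with (S m * 2)%nat by lia.
    rewrite Nat.div_add, Nat.div_mul by lia.
    replace (1 + S m * 2)%nat with (2 * S m + 1)%nat by lia.
    destruct (combA_degree_odd al0 alx al1 be0 be1 (S m)) as [D1 D2].
    split; [exact D1|]. now exists (be1 * (19683 / 64) ^ S m). }
intros A1 A2. rewrite HtypeI. split.
- intros [D1 [D2 [O1 N1]]].
  assert (HU : (forall x, A1 x - combA1 al0 alx al1 (n + 2) x = 0) /\
               (forall x, A2 x - combA2 be0 be1 (n + 2) x = 0)).
  { assert (HO : orthogonal_below a b c d (S (n + 2)) (fun x => A1 x - combA1 al0 alx al1 (n + 2) x)
      (fun x => A2 x - combA2 be0 be1 (n + 2) x)).
    { intros k Hk. assert (Hk' : (k < n + 2 \/ k = n + 2)%nat) by lia. destruct Hk' as [Hk'| ->].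
      - apply mu_int_is_eq with (3 := mu_int_is_lin _ _ _ _ _ _ 1 (-1) _ _ (O1 k Hk') (Ho k Hk')).
        + intros x. unfold linear_form. ring.
        + ring.
      - apply mu_int_is_eq with (3 := mu_int_is_lin _ _ _ _ _ _ 1 (-1) _ _ N1 Hn).
        + intros x. unfold linear_form. ring.
        + ring. }
    assert (D1' : poly_deg_lt (S (Nat.div (n + 2) 2)) (fun x => A1 x - combA1 al0 alx al1 (n + 2) x)).
    { apply poly_deg_lt_ext with (2 := poly_deg_lt_lin _ _ _ 1 (-1) D1 (proj1 Deg)). intros x. ring. }
    assert (D2' : poly_deg_lt (S (Nat.div (n + 1) 2)) (fun x => A2 x - combA2 be0 be1 (n + 2) x)).
    { apply poly_deg_lt_ext with (2 := poly_deg_lt_lin _ _ _ 1 (-1) D2 (proj2 Deg)). intros x. ring. }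
    destruct (Nat.Even_or_Odd n) as [[m En]|[m En]].
    - apply (proj1 (Z (S m))).
      + replace (Nat.div (n + 2) 2) with (S m) in D1'; [exact D1'|].
        subst n. replace (2 * m + 2)%nat with (S m * 2)%nat by lia. now rewrite Nat.div_mul by lia.
      + replace (Nat.div (n + 1) 2) with m in D2'; [exact D2'|].
        subst n. replace (2 * m + 1)%nat with (1 + m * 2)%nat by lia. now rewrite Nat.div_add by lia.
      + now replace (2 * S m)%nat with (n + 2)%nat by lia.
    - apply (proj2 (Z (S m))).
      + replace (Nat.div (n + 2) 2) with (S m) in D1'; [exact D1'|].
        subst n. replace (2 * m + 1 + 2)%nat with (1 + S m * 2)%nat by lia. now rewrite Nat.div_add by lia.
      + replace (Nat.div (n + 1) 2) with (S m) in D2'; [exact D2'|].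
        subst n. replace (2 * m + 1 + 1)%nat with (S m * 2)%nat by lia. now rewrite Nat.div_mul by lia.
      + now replace (2 * S m + 1)%nat with (n + 2)%nat by lia. }
  destruct HU as [U1 U2]. split; intros x.
  + rewrite <- F1. specialize (U1 x). lra.
  + rewrite <- F2. specialize (U2 x). lra.
- intros [H1 H2]. destruct Deg as [D1 D2]. repeat split.
  + apply poly_deg_lt_ext with (2 := D1). intros x. now rewrite F1, H1.
  + apply poly_deg_lt_ext with (2 := D2). intros x. now rewrite F2, H2.
  + intros k Hk. apply mu_int_is_eq with (3 := Ho k Hk); [|reflexivity].
    intros x. unfold linear_form. now rewrite F1, F2, H1, H2.
  + apply mu_int_is_eq with (3 := Hn); [|reflexivity].
    intros x. unfold linear_form. now rewrite F1, F2, H1, H2.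
Qed.

(** * Telescoping the moment sums *)

Definition moment1 (a b c d : R) (k : nat) : R := poch a k * poch b k / (poch c k * poch d k).

Definition moment2 (a b c d : R) (k : nat) : R :=
  poch a k * poch (b + 1) k / (poch (c + 1) k * poch d k).

Lemma moment1_S (a b c d : R) (k : nat) : 0 < c -> 0 < d ->
  moment1 a b c d (S k) =
  (a + INR k) * (b + INR k) / ((c + INR k) * (d + INR k)) * moment1 a b c d k.
Proof.
intros Hc Hd. unfold moment1. simpl poch. assert (H := pos_INR k).
assert (Pc := poch_pos c k Hc). assert (Pd := poch_pos d k Hd).
field. repeat split; lra.
Qed.

Lemma poch_shift (q : R) (k : nat) : q * poch (q + 1) k = (q + INR k) * poch q k.
Proof.
induction k as [|k IH]; [simpl; ring|].
rewrite S_INR. simpl poch. rewrite <- Rmult_assoc, IH. ring.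
Qed.

(** Both moment sequences become rational multiples of one hypergeometric term. Since c (b+k) / (b
    (c+k)) = (c/b) (1 + (b-c) / (c+k)), they span the same sequences as that term and its quotient
    by c + k, which are symmetric in a and b; this is why exchanged tuples share a certificate. *)
Lemma moment2_moment1 (a b c d : R) (k : nat) : 0 < b -> 0 < c -> 0 < d ->
  moment2 a b c d k = c * (b + INR k) / (b * (c + INR k)) * moment1 a b c d k.
Proof.
intros Hb Hc Hd. unfold moment1, moment2. assert (H := pos_INR k).
assert (Pc := poch_pos c k Hc). assert (Pd := poch_pos d k Hd).
replace (poch (b + 1) k) with ((b + INR k) * poch b k / b) by (rewrite <- poch_shift; field; lra).
replace (poch (c + 1) k) with ((c + INR k) * poch c k / c) by (rewrite <- poch_shift; field; lra).
field. repeat split; lra.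
Qed.

Lemma sum_telescope (T G : nat -> R) (M : nat) :
  (forall m, T m = G (S m) - G m) -> sum_f_R0 T M = G (S M) - G 0%nat.
Proof.
intros H. induction M as [|M IH]; simpl; rewrite H; [reflexivity|]. rewrite IH. ring.
Qed.

(* Ratios e_coef (n+1) m / e_coef (n+2) m and e_coef n m / e_coef (n+2) m at x = n, y = m. *)
Definition ratio1 (x y : R) : R := - (4 / 27) * (x + 2 - 2 * y) / (x + y + 4).
Definition ratio0 (x y : R) : R := - (4 / 27) * (x + 1 - 2 * y) / (x + y + 3) * ratio1 x y.

(* By Gosper's algorithm, moment_term is the difference in m of certificate * moment1 * e_coef,
   with Q a polynomial. *)
Definition certificate (Q : R -> R -> R) (x y : R) : R :=
  y * Q x y / ((x + 2) * (x + 3) * (x + 4) * (x + 5) * (x + y + 3) * (x + y + 4)).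

(** The long hypothesis is the telescoping relation T(m) = G(m+1) - G(m), divided by moment1 m times
    e_coef (n+2) m, with x = n and y = m. It involves rational functions only, and multiplying back
    is harmless where e_coef vanishes. *)
Lemma moment_sum_zero (a b c d al0 alx al1 be0 be1 : R) (Q : R -> R -> R) (n : nat) :
  0 < b -> 0 < c -> 0 < d ->
  (forall x y, 0 <= x -> 0 <= y ->
    1 + al1 * ratio1 x y + al0 * ratio0 x y +
    alx * ((a + y) * (b + y) / ((c + y) * (d + y)) * ratio0 x y) +
    c * (b + y) / (b * (c + y)) * (be1 * ratio1 x y + be0 * ratio0 x y) =
    (a + y) * (b + y) / ((c + y) * (d + y)) *
    (19683 / 64 * ((x + y + 5) * (x + y + 4) * (x + y + 3)) /
      ((3 * y + 3) * (3 * y + 4) * (3 * y + 5)) * ratio0 x y) * certificate Q x (y + 1)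
    - certificate Q x y) ->
  sum_f_R0 (moment_term al0 alx al1 be0 be1 (moment1 a b c d) (moment2 a b c d) n) (S (S n)) = 0.
Proof.
intros Hb Hc Hd H.
rewrite (sum_telescope _ (fun m => certificate Q (INR n) (INR m) * moment1 a b c d m * e_coef (S (S n)) m)).
(* The upper end vanishes because m exceeds the degree, the lower end because of the factor y of the
   certificate. *)
- rewrite e_coef_gt by lia. unfold certificate. simpl. unfold Rdiv. ring.
- intros m. assert (Hx := pos_INR n). assert (Hy := pos_INR m). specialize (H _ _ Hx Hy).
  assert (R1 : e_coef (S n) m = ratio1 (INR n) (INR m) * e_coef (S (S n)) m).
  { rewrite (e_coef_Sn (S n)), S_INR. unfold ratio1. field. lra. }
  assert (R0 : e_coef n m = ratio0 (INR n) (INR m) * e_coef (S (S n)) m).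
  { rewrite (e_coef_Sn n), R1. unfold ratio0. field. lra. }
  unfold moment_term. rewrite moment2_moment1, moment1_S, e_coef_SS, R0, R1, S_INR by assumption.
  transitivity ((1 + al1 * ratio1 (INR n) (INR m) + al0 * ratio0 (INR n) (INR m) +
    alx * ((a + INR m) * (b + INR m) / ((c + INR m) * (d + INR m)) * ratio0 (INR n) (INR m)) +
    c * (b + INR m) / (b * (c + INR m)) *
      (be1 * ratio1 (INR n) (INR m) + be0 * ratio0 (INR n) (INR m))) *
    (moment1 a b c d m * e_coef (S (S n)) m)); [ring|].
  rewrite H. ring.
Qed.

Lemma third_not_integer (z : Z) (l : nat) : Z.modulo z 3 <> 0%Z -> IZR z / 3 + INR l <> 0.
Proof.
intros Hz H. apply Hz.
assert (E : IZR (z + 3 * Z.of_nat l) = IZR 0) by (rewrite plus_IZR, mult_IZR, <- INR_IZR_INZ; lra).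
apply eq_IZR in E. replace z with ((- Z.of_nat l) * 3)%Z by lia. apply Z_mod_mult.
Qed.

(** The integer [z] is 3 (a - b); as 3 does not divide it, no shift of a - b by an integer is 0, as
    both moment lemmas require. *)
Lemma typeI_is_certified (p : R) (i j : nat) (z : Z) (a b c d al0 alx al1 be0 be1 : R)
    (Q : R -> R -> R) (n : nat) (P1 P2 : R -> R) :
  0 < p < 1 -> a = p + INR i -> b = 1 - p + INR j -> d = c + 1 / 2 ->
  2 * c = a + b \/ 2 * c = a + b + 1 ->
  a - b = IZR z / 3 -> Z.modulo z 3 <> 0%Z ->
  al1 + be1 = 81 / 4 -> 19683 / 64 + alx <> 0 -> be1 <> 0 ->
  (forall x y, 0 <= x -> 0 <= y ->
    1 + al1 * ratio1 x y + al0 * ratio0 x y +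
    alx * ((a + y) * (b + y) / ((c + y) * (d + y)) * ratio0 x y) +
    c * (b + y) / (b * (c + y)) * (be1 * ratio1 x y + be0 * ratio0 x y) =
    (a + y) * (b + y) / ((c + y) * (d + y)) *
    (19683 / 64 * ((x + y + 5) * (x + y + 4) * (x + y + 3)) /
      ((3 * y + 3) * (3 * y + 4) * (3 * y + 5)) * ratio0 x y) * certificate Q x (y + 1)
    - certificate Q x y) ->
  (forall x, P1 x = (al0 + alx * x) * e (4 / 27) n x + al1 * e (4 / 27) (n + 1) x + e (4 / 27) (n + 2) x) ->
  (forall x, P2 x = be0 * e (4 / 27) n x + be1 * e (4 / 27) (n + 1) x) ->
  typeI_is a b c d (n + 2) P1 P2.
Proof.
intros Hp Ea Eb Ed Hc Eab Hz Hab Hx Hb1 HQ E1 E2.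
assert (Hi := pos_INR i). assert (Hj := pos_INR j).
assert (Hb : 0 < b) by lra. assert (Hc0 : 0 < c) by (destruct Hc; lra). assert (Hd : 0 < d) by lra.
apply (typeI_is_comb a b c d al0 alx al1 be0 be1 (moment1 a b c d) (moment2 a b c d)); auto.
- split; intros k.
  + apply (w1_moment p i j); auto. intros l. rewrite Eab. now apply third_not_integer.
  + apply (w2_moment p i j); auto. intros l.
    replace (a - (b + 1)) with (IZR (z + (-1) * 3) / 3) by (rewrite plus_IZR, mult_IZR; lra).
    apply third_not_integer. now rewrite Z_mod_plus_full.
- unfold moment1. simpl. field.
- unfold moment2. simpl. field.
- intros m. now apply (moment_sum_zero a b c d al0 alx al1 be0 be1 Q).
Qed.

Ltac certified p i j z al0 alx al1 be0 be1 Q :=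
  apply (typeI_is_certified p i j z _ _ _ _ al0 alx al1 be0 be1 Q);
  [ lra | simpl; lra | simpl; lra | lra
  | first [left; lra | right; lra] | lra | discriminate | lra | lra | lra
  | intros x y Hx Hy; unfold certificate, ratio0, ratio1, Q; field; repeat split; lra
  | intros x; field | intros x; field ].

Theorem theorem16 : forall n : nat,
  let E := fun k x => e (4/27) k x in
  typeI_is (1/3) (2/3) (1/2) 1 (n+2)
    (fun x => (729/4 - 6561*x/32) * E n x + 135/4 * E (n+1)%nat x + E (n+2)%nat x)
    (fun x => - (729/8) * E n x - 27/2 * E (n+1)%nat x) /\
  typeI_is (2/3) (1/3) (1/2) 1 (n+2)
    (fun x => (729/16 - 6561*x/32) * E n x + 27/2 * E (n+1)%nat x + E (n+2)%nat x)
    (fun x => 729/16 * E n x + 27/4 * E (n+1)%nat x) /\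
  typeI_is (2/3) (4/3) 1 (3/2) (n+2)
    (fun x => - (3645/16) * E n x + 135/4 * E (n+1)%nat x + E (n+2)%nat x)
    (fun x => 729/4 * E n x - 27/2 * E (n+1)%nat x) /\
  typeI_is (4/3) (2/3) 1 (3/2) (n+2)
    (fun x => 729/16 * E n x + 27/2 * E (n+1)%nat x + E (n+2)%nat x)
    (fun x => - (729/8) * E n x + 27/4 * E (n+1)%nat x) /\
  typeI_is (4/3) (5/3) (3/2) 2 (n+2)
    (fun x => - (729/8) * E n x + 54 * E (n+1)%nat x + E (n+2)%nat x)
    (fun x => - (135/4) * E (n+1)%nat x) /\
  typeI_is (5/3) (4/3) (3/2) 2 (n+2)
    (fun x => - (729/8) * E n x - 27/4 * E (n+1)%nat x + E (n+2)%nat x)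
    (fun x => 27 * E (n+1)%nat x) /\
  typeI_is (1/3) (2/3) 1 (3/2) (n+2)
    (fun x => - (729/8) * E n x - 27/4 * E (n+1)%nat x + E (n+2)%nat x)
    (fun x => 729/4 * E n x + 27 * E (n+1)%nat x) /\
  typeI_is (2/3) (1/3) 1 (3/2) (n+2)
    (fun x => 729/16 * E n x + 27/2 * E (n+1)%nat x + E (n+2)%nat x)
    (fun x => 729/16 * E n x + 27/4 * E (n+1)%nat x) /\
  typeI_is (2/3) (4/3) (3/2) 2 (n+2)
    (fun x => 729/16 * E n x - 189/4 * E (n+1)%nat x + E (n+2)%nat x)
    (fun x => 135/2 * E (n+1)%nat x) /\
  typeI_is (4/3) (2/3) (3/2) 2 (n+2)
    (fun x => 729/16 * E n x + 27/2 * E (n+1)%nat x + E (n+2)%nat x)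
    (fun x => 27/4 * E (n+1)%nat x) /\
  typeI_is (4/3) (5/3) 2 (5/2) (n+2)
    (fun x => - (27/2) * E (n+1)%nat x + E (n+2)%nat x)
    (fun x => 135/4 * E (n+1)%nat x) /\
  typeI_is (5/3) (4/3) 2 (5/2) (n+2)
    (fun x => 27/4 * E (n+1)%nat x + E (n+2)%nat x)
    (fun x => 27/2 * E (n+1)%nat x).
Proof.
intros n E. subst E. cbv beta.
(* One certificate for each pair of tuples exchanged by a <-> b, as these share the forms q^(N). *)
set (Q1 := fun x y => - 2 * (3 * y + 1) * (3 * y + 2) * (x + 3) * (x + 4) * (x + 5)).
set (Q2 := fun x y => - (2 * y + 1) * (3 * x + 8) * (3 * y + 2) * (x + 4) * (x + 5)).
(* Where Q does not factor, it is expanded in powers of x + 2, the index of the form. *)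
set (Q3 := fun x y => - (8 + 24 * y + 16 * y ^ 2 + (18 + 60 * y + 42 * y ^ 2) * (x + 2)
  + (6 + 24 * y + 18 * y ^ 2) * (x + 2) ^ 2) * (x + 5)).
set (Q4 := fun x y => - 2 * (2 * y + 1) * (3 * y + 1) * (3 * y + 2) * (x + 4) * (x + 5)).
set (Q5 := fun x y => - (8 + 36 * y + 52 * y ^ 2 + 24 * y ^ 3
  + (12 + 42 * y + 48 * y ^ 2 + 18 * y ^ 3) * (x + 2)
  + (6 + 15 * y + 9 * y ^ 2) * (x + 2) ^ 2) * (x + 5)).
set (Q6 := fun x y => - (24 + 88 * y + 96 * y ^ 2 + 32 * y ^ 3
  + (54 + 180 * y + 162 * y ^ 2 + 44 * y ^ 3) * (x + 2)
  + (36 + 114 * y + 78 * y ^ 2 + 12 * y ^ 3) * (x + 2) ^ 2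
  + (6 + 22 * y + 12 * y ^ 2) * (x + 2) ^ 3)).
split; [|split; [|split; [|split; [|split; [|split; [|split; [|split; [|split; [|split; [|split]]]]]]]]]].
(* In each row the first entries give a = p + i, b = 1 - p + j and z = 3 (a - b). The next five are
   the coefficients of e_n, x e_n, e_(n+1) in A_1 and of e_n, e_(n+1) in A_2. *)
- certified (1 / 3) 0%nat 0%nat (-1)%Z (729 / 4) (- (6561 / 32)) (135 / 4) (- (729 / 8)) (- (27 / 2)) Q1.
- certified (2 / 3) 0%nat 0%nat 1%Z (729 / 16) (- (6561 / 32)) (27 / 2) (729 / 16) (27 / 4) Q1.
- certified (2 / 3) 0%nat 1%nat (-2)%Z (- (3645 / 16)) 0 (135 / 4) (729 / 4) (- (27 / 2)) Q2.
- certified (1 / 3) 1%nat 0%nat 2%Z (729 / 16) 0 (27 / 2) (- (729 / 8)) (27 / 4) Q2.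
- certified (1 / 3) 1%nat 1%nat (-1)%Z (- (729 / 8)) 0 54 0 (- (135 / 4)) Q3.
- certified (2 / 3) 1%nat 1%nat 1%Z (- (729 / 8)) 0 (- (27 / 4)) 0 27 Q3.
- certified (1 / 3) 0%nat 0%nat (-1)%Z (- (729 / 8)) 0 (- (27 / 4)) (729 / 4) 27 Q4.
- certified (2 / 3) 0%nat 0%nat 1%Z (729 / 16) 0 (27 / 2) (729 / 16) (27 / 4) Q4.
- certified (2 / 3) 0%nat 1%nat (-2)%Z (729 / 16) 0 (- (189 / 4)) 0 (135 / 2) Q5.
- certified (1 / 3) 1%nat 0%nat 2%Z (729 / 16) 0 (27 / 2) 0 (27 / 4) Q5.
- certified (1 / 3) 1%nat 1%nat (-1)%Z 0 0 (- (27 / 2)) 0 (135 / 4) Q6.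
- certified (2 / 3) 1%nat 1%nat 1%Z 0 0 (27 / 4) 0 (27 / 2) Q6.
Qed.
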